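(* Let $\mathfrak g$ be a finite-dimensional complex Lie algebra and $H=U(\mathfrak g)$. Let $R$ be a unital associative $H$-pseudoalgebra with zero left annihilator, $L(R)=0$. Then $R$ is differential: $R\cong\mathrm{Diff}\,A$ for some associative ($X^{cop}$-)algebra $A$. Moreover, if $R$ is finitely generated as a pseudoalgebra, then $A$ is a finitely generated algebra.
   Context: Ground field $\mathbb C$; $H=U(\mathfrak g)$ has its standard Hopf structure $(\Delta,\varepsilon,S)$, Sweedler notation $\Delta(h)=h_{(1)}\otimes h_{(2)}$. Pseudoalgebras. An associative $H$-pseudoalgebra is a left $H$-module $R$ with a linear map $R\otimes R\to (H\otimes H)\otimes_H R$, $a\otimes b\mapsto a*b$ (where $H$ acts on $H\otimes H$ from the right via $\Delta$), such that $(fa)*(gb)=((f\otimes g)\otimes_H 1)(a*b)$ for $f,g\in H$, and $(a*b)*c=a*(b*c)$ in $H^{\otimes 3}\otimes_H R$. Here, if $d*c=\sum_i\beta_i\otimes_H c_i$, then $(\gamma\otimes_H d)*c=\sum_i(\gamma\otimes 1)(\Delta\otimes\mathrm{id})(\beta_i)\otimes_H c_i$, and if $a*d=\sum_i\beta_i\otimes_H c_i$, then $a*(\gamma\otimes_H d)=\sum_i(1\otimes\gamma)(\mathrm{id}\otimes\Delta)(\beta_i)\otimes_H c_i$, for $\gamma\in H\otimes H$. Dual algebra and $x$-products. $X=H^*=\mathrm{Hom}_{\mathbb C}(H,\mathbb C)$ is a commutative algebra with $\langle xy,h\rangle=\langle x,h_{(1)}\rangle\langle y,h_{(2)}\rangle$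 and unit $1=\varepsilon$; it has a coproduct $\Delta:X\to X\hat\otimes X=(H\otimes H)^*$, $\langle x,fg\rangle=\langle x_{(1)},f\rangle\langle x_{(2)},g\rangle$, and antipode $\langle S(x),h\rangle=\langle x,S(h)\rangle$. Writing $a*b=\sum_i(f_i\otimes 1)\otimes_H e_i$, one puts $a_xb=\sum_i\langle S(x),f_i\rangle e_i$ for $x\in X$; so $a*b=\sum_i(S(h_i)\otimes1)\otimes_H(a_{x_i}b)$ for dual bases $\{h_i\}$, $\{x_i\}$ of $H$, $X$. $R$ is finitely generated as a pseudoalgebra if it is the smallest $H$-submodule closed under all $x$-products containing some finite subset. Left annihilator: $L(R)=\{a\in R: a*b=0\ \text{for all } b\in R\}$. Unital. $\mathrm{Cur}\,\mathbb C=He$ is the free rank one $H$-module with $e*e=(1\otimes1)\otimes_H e$. $R$ is unital if there is an embedding of pseudoalgebras $\mathrm{Cur}\,\mathbb C\to R$ such that $e_1r=r$ for all $r\in R$ (equivalently, $R$ as a left $\mathrm{Cur}\,\mathbb C$-module has no nonzero component on which $e$ acts by zero). Differential pseudoalgebras. An $X^{cop}$-algebra is an associative algebra $A$ that is a left $X$-module with $x(ab)=(x_{(2)}a)(x_{(1)}b)$ and such that the annihilator in $X$ of each $a\in A$ has finite codimension. $\mathrm{Diff}\,A$ is the free $H$-module $H\otimes A$ with pseudoproduct determined by $H$-bilinearity and $(1\otimes a)_x(1\otimes b)=1\otimes(a\,x(b))$, $x\in X$. *)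

(* Defs.v *)
From HB Require Import structures.
From mathcomp Require Import all_boot all_order all_algebra.
From mathcomp Require Import boolp classical_sets.
From mathcomp Require Import reals.
From mathcomp Require Export complex.

Set Implicit Arguments.
Unset Strict Implicit.
Unset Printing Implicit Defensive.

Import GRing.Theory.

Local Open Scope ring_scope.
Local Open Scope quotient_scope.

(* M (x)_S N, for abelian groups M and N on which S acts by [ra] (on the right
   of M) and [la] (on the left of N): formal sums of pairs, represented as
   lists, modulo the congruence generated by biadditivity and balancing. *)
Section Tensor.
Variables (S : Type) (M N : zmodType) (ra : M -> S -> M) (la : S -> N -> N).

Inductive tens_rel : seq (M * N) -> seq (M * N) -> Prop :=
| tens_refl s : tens_rel s s
| tens_sym s t : tens_rel s t -> tens_rel t s
| tens_trans s t u : tens_rel s t -> tens_rel t u -> tens_rel s u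
| tens_cat s s' t t' :
    tens_rel s s' -> tens_rel t t' -> tens_rel (s ++ t) (s' ++ t')
| tens_catC s t : tens_rel (s ++ t) (t ++ s)
| tens_0l n : tens_rel [:: (0, n)] [::]
| tens_Dl m m' n : tens_rel [:: (m + m', n)] [:: (m, n); (m', n)]
| tens_Dr m n n' : tens_rel [:: (m, n + n')] [:: (m, n); (m, n')]
| tens_bal m s n : tens_rel [:: (ra m s, n)] [:: (m, la s n)].

Definition tens_relb (s t : seq (M * N)) : bool := `[< tens_rel s t >].

Lemma tens_relb_refl : reflexive tens_relb.
Proof. by move=> s; apply/asboolP; apply: tens_refl. Qed.

Lemma tens_relb_sym : symmetric tens_relb.
Proof. by move=> s t; apply/asboolP/asboolP; apply: tens_sym. Qed.

Lemma tens_relb_trans : transitive tens_relb.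
Proof.
by move=> t s u /asboolP st /asboolP tu; apply/asboolP; apply: tens_trans tu.
Qed.

Canonical tens_equiv := EquivRel tens_relb
  tens_relb_refl tens_relb_sym tens_relb_trans.

Definition tens : Type := {eq_quot tens_relb}.
HB.instance Definition _ := Choice.on tens.
HB.instance Definition _ : EqQuotient _ tens_relb tens := EqQuotient.on tens.

Definition tens_class (s : seq (M * N)) : tens := \pi_tens s.
Definition tpure (m : M) (n : N) : tens := tens_class [:: (m, n)].

Lemma tens_classP s t : tens_class s = tens_class t <-> tens_rel s t.
Proof.
split; first by move/eqP; rewrite eqmodE => /asboolP.
by move=> st; apply/eqP; rewrite eqmodE; apply/asboolP.
Qed.

Lemma tens_classK t : tens_class (repr t) = t.
Proof. exact: reprK. Qed.

Lemma tens_repr s : tens_rel (repr (tens_class s)) s.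
Proof. by apply/tens_classP; rewrite tens_classK. Qed.

Definition tens_add (t u : tens) := tens_class (repr t ++ repr u).
Definition tens_opp (t : tens) :=
  tens_class [seq (- p.1, p.2) | p : M * N <- repr t].

Lemma tens_add_class s t :
  tens_add (tens_class s) (tens_class t) = tens_class (s ++ t).
Proof. by apply/tens_classP; apply: tens_cat; apply: tens_repr. Qed.

Lemma tens_addA : associative tens_add.
Proof.
move=> t u v; rewrite -(tens_classK t) -(tens_classK u) -(tens_classK v).
by rewrite !tens_add_class catA.
Qed.

Lemma tens_addC : commutative tens_add.
Proof. by move=> t u; apply/tens_classP; apply: tens_catC. Qed.

Lemma tens_add0 : left_id (tens_class [::]) tens_add.
Proof. by move=> t; rewrite -(tens_classK t) tens_add_class. Qed.

Lemma tens_addN : left_inverse (tens_class [::]) tens_opp tens_add.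
Proof.
move=> t; rewrite /tens_opp -[t in tens_add _ t]tens_classK.
have cls x s : tens_class (x :: s) = tens_add (tens_class [:: x]) (tens_class s).
  by rewrite tens_add_class.
elim: (repr t) => [|[m n] s IHs]; first exact: tens_add0.
rewrite map_cons (cls (- m, n)) (cls (m, n)).
rewrite -tens_addA [tens_add (tens_class [:: (m, n)]) _]tens_addC.
rewrite (tens_addA (tens_class (map _ s))) IHs tens_add0 tens_add_class.
apply/tens_classP/(tens_trans (tens_sym (tens_Dl _ _ _))).
by rewrite addNr; apply: tens_0l.
Qed.

HB.instance Definition _ :=
  GRing.isZmodule.Build tens tens_addA tens_addC tens_add0 tens_addN.

Lemma tens_classD s t : tens_class (s ++ t) = tens_class s + tens_class t.
Proof. by rewrite -tens_add_class. Qed.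

Lemma tens_classE s : tens_class s = \sum_(p <- s) tpure p.1 p.2.
Proof.
elim: s => [|[m n] s IHs]; first by rewrite big_nil.
by rewrite big_cons -IHs -cat1s tens_classD.
Qed.

Lemma tensP t : exists s, t = \sum_(p <- s) tpure p.1 p.2.
Proof. by exists (repr t); rewrite -tens_classE tens_classK. Qed.

Lemma tens_ind (P : tens -> Prop) :
    P 0 -> (forall t u, P t -> P u -> P (t + u)) ->
    (forall m n, P (tpure m n)) ->
  forall t, P t.
Proof.
move=> P0 PD Pp t; have [s ->] := tensP t.
by elim/big_rec: _ => // p u _ Pu; apply: PD.
Qed.

Lemma tpureDl m m' n : tpure (m + m') n = tpure m n + tpure m' n.
Proof. by rewrite -tens_classD; apply/tens_classP; apply: tens_Dl. Qed.

Lemma tpureDr m n n' : tpure m (n + n') = tpure m n + tpure m n'.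
Proof. by rewrite -tens_classD; apply/tens_classP; apply: tens_Dr. Qed.

Lemma tpure_bal m s n : tpure (ra m s) n = tpure m (la s n).
Proof. by apply/tens_classP; apply: tens_bal. Qed.

(* The additive map induced by f : M x N -> P; it is independent of the chosen
   representative when f is biadditive and balanced ([tliftE]). *)
Definition tlift (P : zmodType) (f : M -> N -> P) (t : tens) : P :=
  \sum_(p <- repr t) f p.1 p.2.

Definition balanced (P : zmodType) (f : M -> N -> P) : Prop :=
  [/\ forall n, {morph f^~ n : m m' / m + m'},
      forall m, {morph f m : n n' / n + n'} &
      forall m s n, f (ra m s) n = f m (la s n)].

Section Lift.
Variables (P : zmodType) (f : M -> N -> P).
Hypothesis fB : balanced f.

Lemma balanced0 n : f 0 n = 0.
Proof. by case: fB => fl _ _; apply: (addrI (f 0 n)); rewrite -fl !addr0. Qed.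

Lemma tlift_class s : tlift f (tens_class s) = \sum_(p <- s) f p.1 p.2.
Proof.
rewrite /tlift; have := tens_repr s; move: (repr _) => s'.
have [fl fr fb] := fB; elim => //=.
- by move=> ? ? ? _ -> _ ->.
- by move=> ? ? ? ? _ IH1 _ IH2; rewrite !big_cat /= IH1 IH2.
- by move=> ? ?; rewrite !big_cat /= addrC.
- by move=> n; rewrite big_seq1 big_nil balanced0.
- by move=> m m' n; rewrite big_seq1 big_cons big_seq1 /= fl.
- by move=> m n n'; rewrite big_seq1 big_cons big_seq1 /= fr.
- by move=> m c n; rewrite !big_seq1 /= fb.
Qed.

Lemma tliftE m n : tlift f (tpure m n) = f m n.
Proof. by rewrite tlift_class big_seq1. Qed.

Lemma tliftD : {morph tlift f : t u / t + u}.
Proof.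
move=> t u; rewrite -(tens_classK t) -(tens_classK u) -tens_classD.
by rewrite !tlift_class big_cat.
Qed.

Lemma tlift0 : tlift f 0 = 0.
Proof. by rewrite tlift_class big_nil. Qed.

End Lift.

Lemma tpure_balanced : balanced tpure.
Proof.
by split=> [n m m'|m n n'|m s n]; rewrite ?tpureDl ?tpureDr ?tpure_bal.
Qed.

End Tensor.

Definition tmap S (M N : zmodType) ra la S' (M' N' : zmodType) ra' la'
    (f : M -> M') (g : N -> N') :
    @tens S M N ra la -> @tens S' M' N' ra' la' :=
  tlift (fun m n => tpure ra' la' (f m) (g n)).
Arguments tmap {S M N ra la S' M' N' ra' la'} f g _.

Section TensorField.
Variable k : fieldType.

Definition tensk (A B : lmodType k) : Type :=
  @tens k A B (fun a c => c *: a) (fun c b => c *: b).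

HB.instance Definition _ A B := GRing.Zmodule.on (tensk A B).

Definition otimes (A B : lmodType k) (a : A) (b : B) : tensk A B := tpure _ _ a b.

End TensorField.

Notation "a ⊗ b" := (otimes a b) (at level 40, left associativity) : ring_scope.

Section TensorModule.
Variables (k : fieldType) (A B : lmodType k).
Implicit Types (a : A) (b : B) (t u : tensk A B).

Definition bilin (P : lmodType k) (f : A -> B -> P) : Prop :=
  (forall b, linear (f^~ b)) /\ (forall a, linear (f a)).

Lemma tensk_ind (P : tensk A B -> Prop) :
    P 0 -> (forall t u, P t -> P u -> P (t + u)) -> (forall a b, P (a ⊗ b)) ->
  forall t, P t.
Proof. exact: tens_ind. Qed.

Lemma otimesDl a a' b : (a + a') ⊗ b = a ⊗ b + a' ⊗ b.
Proof. exact: tpureDl. Qed.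

Lemma otimesDr a b b' : a ⊗ (b + b') = a ⊗ b + a ⊗ b'.
Proof. exact: tpureDr. Qed.

Lemma otimesZ c a b : (c *: a) ⊗ b = a ⊗ (c *: b).
Proof. exact: tpure_bal. Qed.

Definition tensk_scale (c : k) (t : tensk A B) : tensk A B :=
  tlift (fun a b => (c *: a) ⊗ b) t.

Fact tensk_scale_bal c :
  balanced (fun a c => c *: a) (fun c b => c *: b)
    (fun a b => (c *: a) ⊗ b : tensk A B).
Proof.
split=> [b a a'|a b b'|a d b]; first by rewrite scalerDr otimesDl.
  by rewrite otimesDr.
by rewrite -otimesZ !scalerA mulrC.
Qed.

Lemma tensk_scaleE c a b : tensk_scale c (a ⊗ b) = (c *: a) ⊗ b.
Proof. exact: (tliftE (tensk_scale_bal c)). Qed.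

Lemma tensk_scaleDr : right_distributive tensk_scale +%R.
Proof. by move=> c t u; exact: (tliftD (tensk_scale_bal c)). Qed.

Lemma tensk_scale0 c : tensk_scale c 0 = 0.
Proof. exact: (tlift0 (tensk_scale_bal c)). Qed.

Lemma tensk_scaleA c d t :
  tensk_scale c (tensk_scale d t) = tensk_scale (c * d) t.
Proof.
elim/tensk_ind: t => [|t u IHt IHu|a b]; first by rewrite !tensk_scale0.
  by rewrite !tensk_scaleDr IHt IHu.
by rewrite !tensk_scaleE scalerA.
Qed.

Lemma tensk_scale1 : left_id 1 tensk_scale.
Proof.
elim/tensk_ind => [|t u IHt IHu|a b]; first by rewrite !tensk_scale0.
  by rewrite !tensk_scaleDr IHt IHu.
by rewrite !tensk_scaleE scale1r.
Qed.

Lemma tensk_scaleDl t : {morph tensk_scale^~ t : c d / c + d}.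
Proof.
move=> c d; elim/tensk_ind: t => [|t u IHt IHu|a b].
- by rewrite !tensk_scale0 addr0.
- by rewrite !tensk_scaleDr IHt IHu addrACA.
- by rewrite !tensk_scaleE scalerDl otimesDl.
Qed.

HB.instance Definition _ := GRing.Zmodule_isLmodule.Build k (tensk A B)
  tensk_scaleA tensk_scale1 tensk_scaleDr tensk_scaleDl.

Lemma otimesZl c a b : (c *: a) ⊗ b = c *: (a ⊗ b).
Proof. by rewrite -tensk_scaleE. Qed.

Lemma otimesZr c a b : a ⊗ (c *: b) = c *: (a ⊗ b).
Proof. by rewrite -otimesZl otimesZ. Qed.

Lemma otimes_bilin : bilin (@otimes k A B).
Proof.
by split=> [b c a a'|a c b b'];
  rewrite ?otimesDl ?otimesDr ?otimesZl ?otimesZr.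
Qed.

Section LiftLinear.
Variables (P : lmodType k) (f : A -> B -> P).
Hypothesis fB : bilin f.

Lemma bilin_balanced :
  balanced (fun a (c : k) => c *: a) (fun (c : k) b => c *: b) f.
Proof.
have [fl fr] := fB; split=> [b a a'|a b b'|a c b].
- by have := fl b 1 a a'; rewrite !scale1r.
- by have := fr a 1 b b'; rewrite !scale1r.
have f0b b' : f 0 b' = 0.
  by have := fl b' (-1) 0 0; rewrite scaler0 addr0 scaleN1r addNr.
have fa0 a' : f a' 0 = 0.
  by have := fr a' (-1) 0 0; rewrite scaler0 addr0 scaleN1r addNr.
have := fl b c a 0; rewrite addr0 f0b addr0 => ->.
by have := fr a c b 0; rewrite addr0 fa0 addr0 => ->.
Qed.

Lemma tliftkE a b : tlift f (a ⊗ b : tensk A B) = f a b.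
Proof. exact: (tliftE bilin_balanced). Qed.

Lemma tliftk_linear : linear (tlift f : tensk A B -> P).
Proof.
move=> c t u; rewrite (tliftD bilin_balanced); congr (_ + _).
elim/tensk_ind: t => [|t v IHt IHv|a b].
- by rewrite scaler0 (tlift0 bilin_balanced) scaler0.
- by rewrite scalerDr !(tliftD bilin_balanced) IHt IHv scalerDr.
rewrite -otimesZl !tliftkE.
have [/(_ b c a 0)] := fB; rewrite addr0 => -> _.
by have [/(_ b (-1) 0 0)] := fB; rewrite scaler0 addr0 scaleN1r addNr => ->;
   rewrite addr0.
Qed.

End LiftLinear.

End TensorModule.

Section TensorAlgebra.
Variables (k : fieldType) (A B : algType k).
Implicit Types (a : A) (b : B) (t u v : tensk A B).

Definition tensk_mul (t u : tensk A B) : tensk A B :=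
  tlift (fun a b => tlift (fun a' b' => (a * a') ⊗ (b * b')) u) t.

Fact tensk_mul_bilinr a b :
  bilin (fun a' b' => (a * a') ⊗ (b * b') : tensk A B).
Proof.
split=> [b' c a' a''|a' c b' b''].
  by rewrite mulrDr -scalerAr otimesDl otimesZl.
by rewrite mulrDr -scalerAr otimesDr otimesZr.
Qed.

Fact tensk_mul_bilinl u :
  bilin (fun a b => tlift (fun a' b' => (a * a') ⊗ (b * b') : tensk A B) u).
Proof.
have lin a b := tliftk_linear (tensk_mul_bilinr a b).
split=> [b c a a'|a c b b']; elim/tensk_ind: u => [|t u IHt IHu|x y].
- by rewrite !(tlift0 (bilin_balanced (tensk_mul_bilinr _ _))) scaler0 addr0.
- rewrite !(tliftD (bilin_balanced (tensk_mul_bilinr _ _))) IHt IHu.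
  by rewrite scalerDr addrACA.
- rewrite !(tliftkE (tensk_mul_bilinr _ _)) mulrDl -scalerAl.
  by rewrite otimesDl otimesZl.
- by rewrite !(tlift0 (bilin_balanced (tensk_mul_bilinr _ _))) scaler0 addr0.
- rewrite !(tliftD (bilin_balanced (tensk_mul_bilinr _ _))) IHt IHu.
  by rewrite scalerDr addrACA.
- rewrite !(tliftkE (tensk_mul_bilinr _ _)) mulrDl -scalerAl.
  by rewrite otimesDr otimesZr.
Qed.

Lemma tensk_mulE a b a' b' :
  tensk_mul (a ⊗ b) (a' ⊗ b') = (a * a') ⊗ (b * b').
Proof.
by rewrite /tensk_mul (tliftkE (tensk_mul_bilinl _))
           (tliftkE (tensk_mul_bilinr _ _)).
Qed.

Lemma tensk_mulDl : left_distributive tensk_mul +%R.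
Proof. by move=> t t' u; exact: (tliftD (bilin_balanced (tensk_mul_bilinl u))). Qed.

Lemma tensk_mulZl c t u : tensk_mul (c *: t) u = c *: tensk_mul t u.
Proof.
have := tliftk_linear (tensk_mul_bilinl u) c t 0.
by rewrite (tlift0 (bilin_balanced (tensk_mul_bilinl u))) !addr0.
Qed.

Lemma tensk_mul0l u : tensk_mul 0 u = 0.
Proof. exact: (tlift0 (bilin_balanced (tensk_mul_bilinl u))). Qed.

Lemma tensk_mulDr : right_distributive tensk_mul +%R.
Proof.
move=> t u u'; elim/tensk_ind: t => [|t v IHt IHv|a b].
- by rewrite !tensk_mul0l addr0.
- by rewrite !tensk_mulDl IHt IHv addrACA.
rewrite /tensk_mul !(tliftkE (tensk_mul_bilinl _)).
exact: (tliftD (bilin_balanced (tensk_mul_bilinr a b))).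
Qed.

Lemma tensk_mul0r t : tensk_mul t 0 = 0.
Proof. by apply: (addrI (tensk_mul t 0)); rewrite -tensk_mulDr !addr0. Qed.

Lemma tensk_mulZr c t u : tensk_mul t (c *: u) = c *: tensk_mul t u.
Proof.
elim/tensk_ind: t => [|t v IHt IHv|a b].
- by rewrite !tensk_mul0l scaler0.
- by rewrite !tensk_mulDl IHt IHv scalerDr.
elim/tensk_ind: u => [|u v IHu IHv|a' b'].
- by rewrite scaler0 tensk_mul0r scaler0.
- by rewrite scalerDr !tensk_mulDr IHu IHv scalerDr.
by rewrite -otimesZl !tensk_mulE -scalerAr otimesZl.
Qed.

Lemma tensk_mulA : associative tensk_mul.
Proof.
move=> t u v; elim/tensk_ind: t => [|t t' IHt IHt'|a b].
- by rewrite !tensk_mul0l.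
- by rewrite !tensk_mulDl IHt IHt'.
elim/tensk_ind: u => [|t t' IHt IHt'|a' b'].
- by rewrite !(tensk_mul0l, tensk_mul0r).
- by rewrite !(tensk_mulDl, tensk_mulDr) IHt IHt'.
elim/tensk_ind: v => [|t t' IHt IHt'|a'' b''].
- by rewrite !tensk_mul0r.
- by rewrite !tensk_mulDr IHt IHt'.
by rewrite !tensk_mulE !mulrA.
Qed.

Lemma tensk_mul1l : left_id (1 ⊗ 1) tensk_mul.
Proof.
elim/tensk_ind => [|t t' IHt IHt'|a b]; first exact: tensk_mul0r.
  by rewrite tensk_mulDr IHt IHt'.
by rewrite tensk_mulE !mul1r.
Qed.

Lemma tensk_mul1r : right_id (1 ⊗ 1) tensk_mul.
Proof.
elim/tensk_ind => [|t t' IHt IHt'|a b]; first exact: tensk_mul0l.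
  by rewrite tensk_mulDl IHt IHt'.
by rewrite tensk_mulE !mulr1.
Qed.

HB.instance Definition _ := GRing.Zmodule_isPzRing.Build (tensk A B)
  tensk_mulA tensk_mul1l tensk_mul1r tensk_mulDl tensk_mulDr.

Lemma otimesM a b a' b' : (a ⊗ b) * (a' ⊗ b') = (a * a') ⊗ (b * b').
Proof. exact: tensk_mulE. Qed.

End TensorAlgebra.

Definition lie_bracket (k : fieldType) (g : lmodType k) (br : g -> g -> g) :=
  [/\ bilin br, forall x, br x x = 0 &
      forall x y z, br x (br y z) + br y (br z x) + br z (br x y) = 0].

(* U(g), presented as the unital associative algebra generated by the vector
   space g subject to [x, y] = x y - y x: terms modulo the smallest congruence
   containing the algebra laws, the linearity of g -> U(g) and this relation. *)
Section Enveloping.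
Variables (k : fieldType) (g : lmodType k) (br : g -> g -> g).

Inductive uterm : Type :=
| UGen of g
| UCst of k
| UAdd of uterm & uterm
| UMul of uterm & uterm.

Inductive urel : uterm -> uterm -> Prop :=
| urel_refl s : urel s s
| urel_sym s t : urel s t -> urel t s
| urel_trans s t u : urel s t -> urel t u -> urel s u
| urel_add s s' t t' : urel s s' -> urel t t' -> urel (UAdd s t) (UAdd s' t')
| urel_mul s s' t t' : urel s s' -> urel t t' -> urel (UMul s t) (UMul s' t')
| urel_addA s t u : urel (UAdd s (UAdd t u)) (UAdd (UAdd s t) u)
| urel_addC s t : urel (UAdd s t) (UAdd t s)
| urel_mulA s t u : urel (UMul s (UMul t u)) (UMul (UMul s t) u)
| urel_mulDl s t u : urel (UMul (UAdd s t) u) (UAdd (UMul s u) (UMul t u))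
| urel_mulDr s t u : urel (UMul s (UAdd t u)) (UAdd (UMul s t) (UMul s u))
| urel_mul0 s : urel (UMul (UCst 0) s) (UCst 0)
| urel_add0 s : urel (UAdd (UCst 0) s) s
| urel_mul1 s : urel (UMul (UCst 1) s) s
| urel_cstC c s : urel (UMul (UCst c) s) (UMul s (UCst c))
| urel_cstD c d : urel (UCst (c + d)) (UAdd (UCst c) (UCst d))
| urel_cstM c d : urel (UCst (c * d)) (UMul (UCst c) (UCst d))
| urel_genD x y : urel (UGen (x + y)) (UAdd (UGen x) (UGen y))
| urel_genZ c x : urel (UGen (c *: x)) (UMul (UCst c) (UGen x))
| urel_br x y :
    urel (UAdd (UGen (br x y)) (UMul (UGen y) (UGen x)))
         (UMul (UGen x) (UGen y)).

HB.instance Definition _ := gen_eqMixin uterm.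
HB.instance Definition _ := gen_choiceMixin uterm.

Definition urelb (s t : uterm) : bool := `[< urel s t >].

Lemma urelb_refl : reflexive urelb.
Proof. by move=> s; apply/asboolP; apply: urel_refl. Qed.

Lemma urelb_sym : symmetric urelb.
Proof. by move=> s t; apply/asboolP/asboolP; apply: urel_sym. Qed.

Lemma urelb_trans : transitive urelb.
Proof.
by move=> t s u /asboolP st /asboolP tu; apply/asboolP; apply: urel_trans tu.
Qed.

Canonical urel_equiv := EquivRel urelb urelb_refl urelb_sym urelb_trans.

Definition uenv : Type := {eq_quot urelb}.
HB.instance Definition _ := Choice.on uenv.
HB.instance Definition _ : EqQuotient _ urelb uenv := EqQuotient.on uenv.

Definition uclass (t : uterm) : uenv := \pi_uenv t.

Lemma uclassP s t : uclass s = uclass t <-> urel s t.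
Proof.
split; first by move/eqP; rewrite eqmodE => /asboolP.
by move=> st; apply/eqP; rewrite eqmodE; apply/asboolP.
Qed.

Lemma uclassK u : uclass (repr u) = u.
Proof. exact: reprK. Qed.

Lemma uclass_repr t : urel (repr (uclass t)) t.
Proof. by apply/uclassP; rewrite uclassK. Qed.

Definition uadd (u v : uenv) := uclass (UAdd (repr u) (repr v)).
Definition umul (u v : uenv) := uclass (UMul (repr u) (repr v)).
Definition uscale (c : k) (u : uenv) := umul (uclass (UCst c)) u.
Definition uopp (u : uenv) := uscale (-1) u.

Lemma uaddE s t : uadd (uclass s) (uclass t) = uclass (UAdd s t).
Proof. by apply/uclassP; apply: urel_add; apply: uclass_repr. Qed.

Lemma umulE s t : umul (uclass s) (uclass t) = uclass (UMul s t).
Proof. by apply/uclassP; apply: urel_mul; apply: uclass_repr. Qed.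

Lemma uaddA : associative uadd.
Proof.
move=> u v w; rewrite -(uclassK u) -(uclassK v) -(uclassK w) !uaddE.
by apply/uclassP; apply: urel_addA.
Qed.

Lemma uaddC : commutative uadd.
Proof. by move=> u v; apply/uclassP; apply: urel_addC. Qed.

Lemma uadd0 : left_id (uclass (UCst 0)) uadd.
Proof.
by move=> u; rewrite -(uclassK u) uaddE; apply/uclassP; apply: urel_add0.
Qed.

Lemma umulA : associative umul.
Proof.
move=> u v w; rewrite -(uclassK u) -(uclassK v) -(uclassK w) !umulE.
by apply/uclassP; apply: urel_mulA.
Qed.

Lemma umulDl : left_distributive umul uadd.
Proof.
move=> u v w; rewrite -(uclassK u) -(uclassK v) -(uclassK w).
by rewrite !(umulE, uaddE); apply/uclassP; apply: urel_mulDl.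
Qed.

Lemma umulDr : right_distributive umul uadd.
Proof.
move=> u v w; rewrite -(uclassK u) -(uclassK v) -(uclassK w).
by rewrite !(umulE, uaddE); apply/uclassP; apply: urel_mulDr.
Qed.

Lemma umul1 : left_id (uclass (UCst 1)) umul.
Proof.
by move=> u; rewrite -(uclassK u) umulE; apply/uclassP; apply: urel_mul1.
Qed.

Lemma ucstC c u : umul (uclass (UCst c)) u = umul u (uclass (UCst c)).
Proof.
by rewrite -(uclassK u) !umulE; apply/uclassP; apply: urel_cstC.
Qed.

Lemma umul1r : right_id (uclass (UCst 1)) umul.
Proof. by move=> u; rewrite -ucstC umul1. Qed.

Lemma ucstD c d :
  uclass (UCst (c + d)) = uadd (uclass (UCst c)) (uclass (UCst d)).
Proof. by rewrite uaddE; apply/uclassP; apply: urel_cstD. Qed.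

Lemma ucstM c d :
  uclass (UCst (c * d)) = umul (uclass (UCst c)) (uclass (UCst d)).
Proof. by rewrite umulE; apply/uclassP; apply: urel_cstM. Qed.

Lemma uaddN : left_inverse (uclass (UCst 0)) uopp uadd.
Proof.
move=> u; rewrite -[u in uadd _ u]umul1 -umulDl -ucstD addNr.
by rewrite -(uclassK u) umulE; apply/uclassP; apply: urel_mul0.
Qed.

HB.instance Definition _ :=
  GRing.isZmodule.Build uenv uaddA uaddC uadd0 uaddN.

HB.instance Definition _ := GRing.Zmodule_isPzRing.Build uenv
  umulA umul1 umul1r umulDl umulDr.

Lemma uscaleA c d u : uscale c (uscale d u) = uscale (c * d) u.
Proof. by rewrite /uscale umulA ucstM. Qed.

Lemma uscaleDr : right_distributive uscale +%R.
Proof. by move=> c u v; apply: umulDr. Qed.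

Lemma uscaleDl u : {morph uscale^~ u : c d / c + d}.
Proof. by move=> c d; rewrite /uscale ucstD; apply: umulDl. Qed.

HB.instance Definition _ := GRing.Zmodule_isLmodule.Build k uenv
  uscaleA umul1 uscaleDr uscaleDl.

Section Eval.
Variables (A : algType k) (f : g -> A).

Fixpoint uterm_eval (t : uterm) : A :=
  match t with
  | UGen x => f x
  | UCst c => c%:A
  | UAdd s t => uterm_eval s + uterm_eval t
  | UMul s t => uterm_eval s * uterm_eval t
  end.

(* The algebra morphism U(g) -> A extending f; independent of the chosen
   representative when f is a morphism of Lie algebras ([uevalE]). *)
Definition ueval (u : uenv) : A := uterm_eval (repr u).

Definition lie_morphism : Prop :=
  linear f /\ forall x y, f (br x y) = f x * f y - f y * f x.

Hypothesis fL : lie_morphism.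

Lemma uevalE t : ueval (uclass t) = uterm_eval t.
Proof.
rewrite /ueval; have := uclass_repr t; move: (repr _) => s.
have [flin fbr] := fL.
have f0 : f 0 = 0 by have := flin (-1) 0 0; rewrite scaler0 addr0 scaleN1r addNr.
elim => //=.
- by move=> ? ? ? _ -> _ ->.
- by move=> ? ? ? ? _ -> _ ->.
- by move=> ? ? ? ? _ -> _ ->.
- by move=> *; rewrite addrA.
- by move=> *; rewrite addrC.
- by move=> *; rewrite mulrA.
- by move=> *; rewrite mulrDl.
- by move=> *; rewrite mulrDr.
- by move=> *; rewrite scale0r mul0r.
- by move=> *; rewrite scale0r add0r.
- by move=> *; rewrite scale1r mul1r.
- by move=> *; rewrite mulr_algl mulr_algr.
- by move=> *; rewrite scalerDl.
- by move=> *; rewrite mulr_algl scalerA.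
- by move=> x y; have := flin 1 x y; rewrite !scale1r.
- by move=> c x; have := flin c x 0; rewrite f0 !addr0 mulr_algl.
- by move=> x y; rewrite fbr subrK.
Qed.

Lemma ueval_gen x : ueval (uclass (UGen x)) = f x.
Proof. exact: uevalE. Qed.

Lemma ueval_linear : linear ueval.
Proof.
move=> c u v; rewrite -(uclassK u) -(uclassK v).
rewrite [c *: _]umulE [X in ueval X]uaddE !uevalE /=.
by rewrite mulr_algl.
Qed.

Lemma ueval1 : ueval 1 = 1.
Proof. by rewrite [LHS]uevalE /= scale1r. Qed.

Lemma uevalM : {morph ueval : u v / u * v}.
Proof.
move=> u v; rewrite -(uclassK u) -(uclassK v).
by rewrite [X in ueval X]umulE !uevalE.
Qed.

End Eval.

Definition uconst0 (x : g) : k^o := 0.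

Lemma uconst0_lie : lie_morphism uconst0.
Proof.
by split=> [c x y|x y]; rewrite /uconst0 ?scaler0 ?addr0 ?mulr0 ?subr0.
Qed.

Definition counit (u : uenv) : k := ueval uconst0 u.

Lemma counit_linear : scalar counit.
Proof. exact: (ueval_linear uconst0_lie). Qed.

Lemma counit1 : counit 1 = 1.
Proof. exact: (ueval1 uconst0_lie). Qed.

Lemma counitM : {morph counit : u v / u * v}.
Proof. exact: (uevalM uconst0_lie). Qed.

Fact uenv_oner_neq0 : (1 : uenv) != 0.
Proof.
apply/eqP => e10; have := counit1; rewrite e10.
have := counit_linear (-1) 0 0.
rewrite scaler0 addr0 mulN1r addNr => -> /esym/eqP.
by rewrite oner_eq0.
Qed.

HB.instance Definition _ := GRing.PzSemiRing_isNonZero.Build uenv uenv_oner_neq0.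

Fact uscaleAl (c : k) (u v : uenv) : c *: (u * v) = (c *: u) * v.
Proof. exact: umulA. Qed.

HB.instance Definition _ :=
  GRing.LSemiModule_isLSemiAlgebra.Build k uenv uscaleAl.

Fact uscaleAr (c : k) (u v : uenv) : c *: (u * v) = u * (c *: v).
Proof. by rewrite [RHS]umulA -ucstC -umulA. Qed.

HB.instance Definition _ :=
  GRing.LSemiAlgebra_isSemiAlgebra.Build k uenv uscaleAr.

Definition ugen (x : g) : uenv := uclass (UGen x).

Lemma ugen_linear : linear ugen.
Proof.
move=> c x y; rewrite [c *: ugen x]umulE [RHS]uaddE; apply/uclassP.
apply: urel_trans (urel_genD _ _) (urel_add _ (urel_refl _)).
exact: urel_genZ.
Qed.

Lemma ugen_br x y : ugen (br x y) = ugen x * ugen y - ugen y * ugen x.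
Proof.
apply: (addIr (ugen y * ugen x)); rewrite subrK.
rewrite [ugen y * _]umulE [ugen x * _]umulE [LHS]uaddE.
by apply/uclassP; apply: urel_br.
Qed.

Lemma uenv_ind (P : uenv -> Prop) :
    (forall x, P (ugen x)) -> (forall c : k, P c%:A) ->
    (forall u v, P u -> P v -> P (u + v)) ->
    (forall u v, P u -> P v -> P (u * v)) ->
  forall u, P u.
Proof.
move=> Pg Pc PD PM u; rewrite -(uclassK u); elim: (repr u) => [x|c|s Ps t Pt|s Ps t Pt].
- exact: Pg.
- by have := Pc c; rewrite -[c%:A]/(uscale c 1) /uscale -[1]/(uclass (UCst 1)) umul1r.
- by rewrite -uaddE; apply: PD.
- by rewrite -umulE; apply: PM.
Qed.

End Enveloping.

Section ConverseAlgebra.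
Variables (k : fieldType) (A : algType k).

HB.instance Definition _ := GRing.Zmodule_isLmodule.Build k A^c
  (@scalerA k A) (@scale1r k A) (@scalerDr k A) (fun v a b => scalerDl v a b).
HB.instance Definition _ := GRing.LSemiModule_isLSemiAlgebra.Build k A^c
  (fun c u v => @scalerAr k A c v u).
HB.instance Definition _ := GRing.LSemiAlgebra_isSemiAlgebra.Build k A^c
  (fun c u v => @scalerAl k A c v u).

End ConverseAlgebra.

Section Hopf.
Variables (k : fieldType) (g : lmodType k) (br : g -> g -> g).

Local Notation H := (uenv br).

Definition counit2 (t : tensk H H) : k^o :=
  tlift (fun u v : H => counit u * counit v : k^o) t.

Fact counit2_bilin : bilin (fun u v : H => counit u * counit v : k^o).
Proof.
split=> [v c u u'|u c v v'] /=; rewrite counit_linear.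
  by rewrite mulrDl -mulrA.
by rewrite mulrDr mulrCA.
Qed.

Fact tensk_uenv_oner_neq0 : (1 : tensk H H) != 0.
Proof.
apply/eqP => e10.
have := tliftkE counit2_bilin 1 1; rewrite -[1 ⊗ 1]/(1 : tensk H H) e10.
rewrite (tlift0 (bilin_balanced counit2_bilin)) counit1 mulr1 => /esym/eqP.
by rewrite oner_eq0.
Qed.

HB.instance Definition _ :=
  GRing.PzSemiRing_isNonZero.Build (tensk H H) tensk_uenv_oner_neq0.
HB.instance Definition _ := GRing.LSemiModule_isLSemiAlgebra.Build k (tensk H H)
  (fun c u v => esym (tensk_mulZl c u v)).
HB.instance Definition _ := GRing.LSemiAlgebra_isSemiAlgebra.Build k (tensk H H)
  (fun c u v => esym (tensk_mulZr c u v)).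

Local Notation H2 := (tensk H H).

Definition coprod_gen (x : g) : H2 := ugen br x ⊗ 1 + 1 ⊗ ugen br x.

Fact coprod_gen_lie : lie_morphism br coprod_gen.
Proof.
split=> [c x y|x y]; rewrite /coprod_gen.
  by rewrite ugen_linear otimesDl otimesDr otimesZl otimesZr scalerDr addrACA.
have otimesNl (u v : H) : (- u) ⊗ v = - (u ⊗ v) :> H2.
  by rewrite -scaleN1r otimesZl scaleN1r.
have otimesNr (u v : H) : u ⊗ (- v) = - (u ⊗ v) :> H2.
  by rewrite -scaleN1r otimesZr scaleN1r.
rewrite ugen_br !(mulrDl, mulrDr) !otimesM !(mul1r, mulr1).
rewrite otimesDl otimesDr otimesNl otimesNr.
have swap (p q r s a b : H2) :
    p - q + (r - s) = p + a + (b + r) - (q + b + (a + s)).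
  rewrite (addrC b r) (addrC a s) [p + a + _]addrACA [q + b + _]addrACA.
  by rewrite (addrC b a) opprD [RHS]addrACA subrr addr0 opprD [RHS]addrACA.
exact: swap.
Qed.

Definition coprod (h : H) : H2 := ueval coprod_gen h.

(* The antipode is the antimorphism H -> H, i.e. the morphism to the converse
   algebra, extending x |-> -x. *)
Definition antipode_gen (x : g) : H^c := - ugen br x.

Fact antipode_gen_lie : lie_morphism br antipode_gen.
Proof.
split=> [c x y|x y]; rewrite /antipode_gen.
  by rewrite ugen_linear opprD -scalerN.
rewrite ugen_br opprB; congr (_ - _); exact: (esym (mulrNN _ _)).
Qed.

Definition antipode (h : H) : H := ueval antipode_gen h.

End Hopf.

Section Dual.
Variables (k : fieldType) (V : lmodType k).

Definition dual : Type := {scalar V}.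
HB.instance Definition _ := gen_eqMixin dual.
HB.instance Definition _ := gen_choiceMixin dual.

Definition pairing (x : dual) : V -> k := (x : {scalar V}).

Lemma pairing_linear x : scalar (pairing x).
Proof. exact: linearP. Qed.

Lemma dual_ext (x y : dual) : pairing x =1 pairing y -> x = y.
Proof.
case: x y => [f [Df Zf]] [f' [Df' Zf']] /= /funext /= ff'.
rewrite /pairing /= in ff'; case: _ / ff' in Df' Zf' *.
case: Df Df' Zf Zf' => [Df] [Df'] [Zf] [Zf'].
by rewrite (Prop_irrelevance Df Df') (Prop_irrelevance Zf Zf').
Qed.

Definition mkdual (f : V -> k) (fL : scalar f) : dual :=
  HB.pack_for {scalar V} f (GRing.isLinear.Build k V k *%R f fL).

Lemma mkdualE f fL v : pairing (@mkdual f fL) v = f v.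
Proof. by []. Qed.

Fact dual_zero_linear : scalar (fun _ : V => 0 : k).
Proof. by move=> c u v; rewrite mulr0 addr0. Qed.

Fact dual_opp_linear (x : dual) : scalar (fun v => - pairing x v).
Proof. by move=> c u v; rewrite pairing_linear opprD mulrN. Qed.

Fact dual_add_linear (x y : dual) : scalar (fun v => pairing x v + pairing y v).
Proof. by move=> c u v; rewrite !pairing_linear mulrDr addrACA. Qed.

Fact dual_scale_linear (d : k) (x : dual) : scalar (fun v => d * pairing x v).
Proof. by move=> c u v; rewrite pairing_linear mulrDr mulrCA. Qed.

Definition dual_add x y := mkdual (dual_add_linear x y).
Definition dual_opp x := mkdual (dual_opp_linear x).
Definition dual_scale d x := mkdual (dual_scale_linear d x).

Fact dual_addA : associative dual_add.
Proof. by move=> x y z; apply: dual_ext => v; rewrite !mkdualE addrA. Qed.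
Fact dual_addC : commutative dual_add.
Proof. by move=> x y; apply: dual_ext => v; rewrite !mkdualE addrC. Qed.
Fact dual_add0 : left_id (mkdual dual_zero_linear) dual_add.
Proof. by move=> x; apply: dual_ext => v; rewrite !mkdualE add0r. Qed.
Fact dual_addN : left_inverse (mkdual dual_zero_linear) dual_opp dual_add.
Proof. by move=> x; apply: dual_ext => v; rewrite !mkdualE addNr. Qed.

HB.instance Definition _ :=
  GRing.isZmodule.Build dual dual_addA dual_addC dual_add0 dual_addN.

Fact dual_scaleA c d x : dual_scale c (dual_scale d x) = dual_scale (c * d) x.
Proof. by apply: dual_ext => v; rewrite !mkdualE mulrA. Qed.
Fact dual_scale1 : left_id 1 dual_scale.
Proof. by move=> x; apply: dual_ext => v; rewrite !mkdualE mul1r. Qed.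
Fact dual_scaleDr : right_distributive dual_scale +%R.
Proof. by move=> c x y; apply: dual_ext => v; rewrite !mkdualE mulrDr. Qed.
Fact dual_scaleDl x : {morph dual_scale^~ x : c d / c + d}.
Proof. by move=> c d; apply: dual_ext => v; rewrite !mkdualE mulrDl. Qed.

HB.instance Definition _ := GRing.Zmodule_isLmodule.Build k dual
  dual_scaleA dual_scale1 dual_scaleDr dual_scaleDl.

End Dual.

(* For a subspace J: finitely many vectors span V / J. *)
Definition finite_codim (k : fieldType) (V : lmodType k) (J : set V) : Prop :=
  exists s : seq V, forall v, exists c : 'I_(size s) -> k,
    J (v - \sum_(i < size s) c i *: s`_i).

Section DualAlgebra.
Variables (k : fieldType) (g : lmodType k) (br : g -> g -> g).

Local Notation H := (uenv br).
Local Notation X := (dual H).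

Definition xmul_fun (x y : X) (h : H) : k^o :=
  tlift (fun h1 h2 : H => pairing x h1 * pairing y h2 : k^o) (coprod h).

Fact xmul_bilin (x y : X) :
  bilin (fun h1 h2 : H => pairing x h1 * pairing y h2 : k^o).
Proof.
split=> [v c u u'|u c v v'] /=; rewrite pairing_linear.
  by rewrite mulrDl -mulrA.
by rewrite mulrDr mulrCA.
Qed.

Fact xmul_linear x y : scalar (xmul_fun x y).
Proof.
move=> c u v; rewrite /xmul_fun [coprod _](ueval_linear (coprod_gen_lie br)).
exact: (tliftk_linear (xmul_bilin x y)).
Qed.

Definition xone : X := mkdual (@counit_linear k g br).
Definition xmul (x y : X) : X := mkdual (xmul_linear x y).

End DualAlgebra.

Section Pseudoalgebras.
Variables (k : fieldType) (g : lmodType k) (br : g -> g -> g).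

Local Notation H := (uenv br).
Local Notation H2 := (tensk H H).
Local Notation H3 := (tensk H2 H).
Local Notation X := (dual H).

Definition coprod_id (t : H2) : H3 :=
  tmap (fun f : H => coprod f) (fun h : H => h) t.

Definition id_coprod (t : H2) : H3 :=
  tlift (fun f h : H =>
    tlift (fun h1 h2 : H => (f ⊗ h1 : H2) ⊗ h2 : H3) (coprod h)) t.

Definition one_otimes (t : H2) : H3 :=
  tlift (fun f h : H => (1 ⊗ f : H2) ⊗ h : H3) t.

(* The right actions of H on H (x) H and H (x) H (x) H. *)
Definition ract2 (t : H2) (h : H) : H2 := t * coprod h.
Definition ract3 (t : H3) (h : H) : H3 := t * coprod_id (coprod h).

Section Products.
Variable R : lmodType H.

Definition htens2 : Type := tens ract2 (fun (h : H) (r : R) => h *: r).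
Definition htens3 : Type := tens ract3 (fun (h : H) (r : R) => h *: r).

HB.instance Definition _ := GRing.Zmodule.on htens2.
HB.instance Definition _ := GRing.Zmodule.on htens3.

Definition hpure2 (t : H2) (r : R) : htens2 := tpure _ _ t r.

(* The left action ((f (x) g) (x)_H 1) of H (x) H on (H (x) H) (x)_H R. *)
Definition lact2 (u : H2) (z : htens2) : htens2 :=
  tmap (fun t : H2 => u * t) (fun r : R => r) z.

Definition pprod : Type := R -> R -> htens2.

Variable p : pprod.

(* C-bilinearity is the case where f and g are scalars. *)
Definition pseudoproduct : Prop :=
  [/\ forall b, {morph p^~ b : a a' / a + a'},
      forall a, {morph p a : b b' / b + b'} &
      forall (f g : H) a b, p (f *: a) (g *: b) = lact2 (f ⊗ g) (p a b)].

(* (gamma (x)_H d) * c and a * (gamma (x)_H d); the lifted maps are balanced when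
   p is a pseudoproduct. *)
Definition pprod_l (z : htens2) (c : R) : htens3 :=
  tlift (fun (u : H2) d =>
    tmap (fun t : H2 => (u ⊗ 1) * coprod_id t) (fun r : R => r) (p d c)
      : htens3) z.

Definition pprod_r (a : R) (z : htens2) : htens3 :=
  tlift (fun (u : H2) d =>
    tmap (fun t : H2 => one_otimes u * id_coprod t) (fun r : R => r) (p a d)
      : htens3) z.

Definition assoc_pseudoalgebra : Prop :=
  pseudoproduct /\
  forall a b c, pprod_l (p a b) c = pprod_r a (p b c).

(* If a * b = \sum_i (f_i (x) 1) (x)_H e_i then a_x b = \sum_i <S(x), f_i> e_i,
   where <S(x), f> = <x, S(f)>; for a pseudoproduct such an expression always exists, and the result does not depend on it. *)
Definition xprod (x : X) (a b : R) : R :=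
  let s := xget [::]
    [set s : seq (H * R) | p a b = \sum_(q <- s) hpure2 (q.1 ⊗ 1) q.2] in
  \sum_(q <- s) (pairing x (antipode q.1))%:A *: q.2.

Definition left_annihilator : set R := [set a | forall b, p a b = 0].

Definition sub_pseudoalgebra (P : set R) : Prop :=
  [/\ P 0, forall a b, P a -> P b -> P (a + b),
      forall (h : H) a, P a -> P (h *: a) &
      forall x a b, P a -> P b -> P (xprod x a b)].

Definition fg_pseudoalgebra : Prop :=
  exists s : seq R, forall P : set R,
    sub_pseudoalgebra P -> (forall a, a \in s -> P a) -> forall a, P a.

End Products.

Definition pseudo_morphism (R R' : lmodType H) (p : pprod R) (p' : pprod R')
    (phi : {linear R -> R'}) : Prop :=
  forall a b, p' (phi a) (phi b) = tmap (fun t : H2 => t) phi (p a b).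

Definition pseudo_iso (R R' : lmodType H) (p : pprod R) (p' : pprod R') : Prop :=
  exists2 phi : {linear R -> R'}, bijective phi & pseudo_morphism p p' phi.

(* Cur C = H e, with e = 1 in the regular module H. *)
Definition cur_prod : pprod H^o := fun f g => hpure2 (f ⊗ g) (1 : H^o).

Definition unital (R : lmodType H) (p : pprod R) : Prop :=
  exists phi : {linear H^o -> R},
    [/\ injective phi, pseudo_morphism cur_prod p phi &
        forall r, xprod p (xone br) (phi 1) r = r].

(* Associative algebras, not assumed to have a unit, with a locally finite
   action of X.  In x (a b) = (x_(2) a) (x_(1) b) the coproduct of x lies in
   the completion of X (x) X, i.e. in (H (x) H)^*; only its image in
   X/Ann(b) (x) X/Ann(a) matters, that is, its restriction to
   Ann(b)^perp (x) Ann(a)^perp, and \sum_(q <- s) q.1 (x) q.2 stands for any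
   tensor with that restriction. *)
Definition annih (A : lmodType k) (act : X -> A -> A) (a : A) : set X :=
  [set x | act x a = 0].

Definition perp (J : set X) : set H :=
  [set h | forall x, J x -> pairing x h = 0].

Record xcop_algebra : Type := XcopAlgebra {
  xcop_mod :> lmodType k;
  amul : xcop_mod -> xcop_mod -> xcop_mod;
  act : X -> xcop_mod -> xcop_mod;
  amul_bilin : bilin amul;
  amulA : associative amul;
  act_bilin : bilin act;
  act1 : forall a, act (xone br) a = a;
  actM : forall x y a, act (xmul x y) a = act x (act y a);
  act_fin : forall a, finite_codim (annih act a);
  act_amul : forall (x : X) a b (s : seq (X * X)),
    (forall f g, perp (annih act b) f -> perp (annih act a) g ->
       pairing x (f * g) = \sum_(q <- s) pairing q.1 f * pairing q.2 g) ->
    act x (amul a b) = \sum_(q <- s) amul (act q.2 a) (act q.1 b)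
}.

Definition fg_algebra (A : xcop_algebra) : Prop :=
  exists s : seq A, forall P : set A,
    [/\ P 0, forall a b, P a -> P b -> P (a + b),
        forall (c : k) a, P a -> P (c *: a) &
        forall a b, P a -> P b -> P (amul a b)] ->
    (forall a, a \in s -> P a) -> forall a, P a.

Section DiffModule.
Variable A : lmodType k.

Definition diffmod : Type := tensk H A.
HB.instance Definition _ := GRing.Zmodule.on diffmod.

Definition diff_scale (h : H) (t : diffmod) : diffmod :=
  tlift (fun (f : H) (a : A) => (h * f) ⊗ a : tensk H A) t.

Fact diff_scale_bilin (h : H) :
  bilin (fun (f : H) (a : A) => (h * f) ⊗ a : tensk H A).
Proof.
split=> [a c f f'|f c a a'].
  by rewrite mulrDr -scalerAr otimesDl otimesZl.
by rewrite otimesDr otimesZr.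
Qed.

Lemma diff_scaleE h f a : diff_scale h (f ⊗ a) = (h * f) ⊗ a.
Proof. exact: (tliftkE (diff_scale_bilin h)). Qed.

Lemma diff_scaleDr : right_distributive diff_scale +%R.
Proof. by move=> h t u; exact: (tliftD (bilin_balanced (diff_scale_bilin h))). Qed.

Lemma diff_scale0 h : diff_scale h 0 = 0.
Proof. exact: (tlift0 (bilin_balanced (diff_scale_bilin h))). Qed.

Lemma diff_scaleA h h' t : diff_scale h (diff_scale h' t) = diff_scale (h * h') t.
Proof.
elim/tensk_ind: t => [|t u IHt IHu|f a]; first by rewrite !diff_scale0.
  by rewrite !diff_scaleDr IHt IHu.
by rewrite !diff_scaleE mulrA.
Qed.

Lemma diff_scale1 : left_id 1 diff_scale.
Proof.
elim/tensk_ind => [|t u IHt IHu|f a]; first by rewrite diff_scale0.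
  by rewrite diff_scaleDr IHt IHu.
by rewrite diff_scaleE mul1r.
Qed.

Lemma diff_scaleDl t : {morph diff_scale^~ t : h h' / h + h'}.
Proof.
move=> h h'; elim/tensk_ind: t => [|t u IHt IHu|f a].
- by rewrite !diff_scale0 addr0.
- by rewrite !diff_scaleDr IHt IHu addrACA.
- by rewrite !diff_scaleE mulrDl otimesDl.
Qed.

HB.instance Definition _ := GRing.Zmodule_isLmodule.Build H diffmod
  diff_scaleA diff_scale1 diff_scaleDr diff_scaleDl.

End DiffModule.

(* q is the pseudoproduct of Diff A; these conditions determine q. *)
Definition diff_pprod (A : xcop_algebra) (q : pprod (diffmod A)) : Prop :=
  pseudoproduct q /\
  forall (x : X) (a b : A),
    xprod q x (1 ⊗ a : diffmod A) (1 ⊗ b : diffmod A)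
      = (1 ⊗ amul a (act x b) : diffmod A).

End Pseudoalgebras.

(* Main.v *)
Require Import Defs.
From HB Require Import structures.
From mathcomp Require Import all_boot all_order all_algebra.
From mathcomp Require Import boolp classical_sets reals complex.

Set Implicit Arguments.
Unset Strict Implicit.
Unset Printing Implicit Defensive.

Import GRing.Theory.

Local Open Scope ring_scope.
Local Open Scope classical_set_scope.

(** Untwisting (H (x) H) (x)_H R = H (x) R, by f (x) g (x)_H r |-> f S(g_1) (x) g_2 r,
    turns the pseudoproduct into a map D : R (x) R -> H (x) R, and its counit part
    into an ordinary associative product r . s on R.  Let e be the unit of R and mu
    the action of H.  Associativity gives D(mu D(r,e), s) = D(r, e . s) = D(r, s),
    hence mu D(r,e) = r because the left annihilator vanishes.  Since e is a left
    unit for the dot product, r |-> r . e is an idempotent; its fixed points form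
    the algebra A, on which X acts through the coaction a |-> D(e,a).  Then
    r |-> (id (x) (- . e)) D(r,e) is the isomorphism R -> H (x) A, with inverse the
    action h (x) a |-> h a.

    For finite generation, the coaction is locally finite, so the A-components of
    finitely many generators of R lie in a finite set T with stable span;
    if B is the subalgebra generated by T then H (x) B is a subpseudoalgebra
    containing the generators, so B = A. *)

(** * Linear maps out of tensor products, dual spaces, and independent expressions of tensors *)

Section LinearTensor.
Variable k : fieldType.

(** The same function as [tlift], with the proof of bilinearity as an argument, so that linearity
    can be registered as a structure and the generic lemmas on linear maps apply. *)
Definition tlin (A B P : lmodType k) (f : A -> B -> P) (fB : bilin f) :
  tensk A B -> P := tlift f.

HB.instance Definition _ (A B P : lmodType k) (f : A -> B -> P) (fB : bilin f) :=
  GRing.isLinear.Build k (tensk A B) P *:%R (tlin fB) (tliftk_linear fB).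

Lemma tlinE (A B P : lmodType k) (f : A -> B -> P) (fB : bilin f) a b :
  tlin fB (a ⊗ b) = f a b.
Proof. exact: tliftkE. Qed.

Section Bilin.
Variables (A B P : lmodType k) (f : A -> B -> P).
Hypothesis fB : bilin f.

Lemma bilinDl a a' b : f (a + a') b = f a b + f a' b.
Proof. by have := fB.1 b 1 a a'; rewrite !scale1r. Qed.

Lemma bilinDr a b b' : f a (b + b') = f a b + f a b'.
Proof. by have := fB.2 a 1 b b'; rewrite !scale1r. Qed.

Lemma bilin0l b : f 0 b = 0.
Proof. by apply: (addrI (f 0 b)); rewrite -bilinDl !addr0. Qed.

Lemma bilin0r a : f a 0 = 0.
Proof. by apply: (addrI (f a 0)); rewrite -bilinDr !addr0. Qed.

Lemma bilinZl c a b : f (c *: a) b = c *: f a b.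
Proof. by have := fB.1 b c a 0; rewrite !addr0 bilin0l addr0. Qed.

Lemma bilinZr c a b : f a (c *: b) = c *: f a b.
Proof. by have := fB.2 a c b 0; rewrite !addr0 bilin0r addr0. Qed.

Lemma bilin_suml (I : Type) (r : seq I) (F : I -> A) b :
  f (\sum_(i <- r) F i) b = \sum_(i <- r) f (F i) b.
Proof. by elim/big_rec2: _ => [|i u v _ <-]; rewrite ?bilin0l ?bilinDl. Qed.

Lemma bilin_sumr (I : Type) (r : seq I) (F : I -> B) a :
  f a (\sum_(i <- r) F i) = \sum_(i <- r) f a (F i).
Proof. by elim/big_rec2: _ => [|i u v _ <-]; rewrite ?bilin0r ?bilinDr. Qed.

End Bilin.

Section Map.
Variables (A B A' B' : lmodType k) (f : {linear A -> A'}) (g : {linear B -> B'}).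

Fact tmapk_bilin : bilin (fun a b => f a ⊗ g b : tensk A' B').
Proof.
split=> [b c a a'|a c b b']; rewrite linearP.
  by rewrite otimesDl otimesZl.
by rewrite otimesDr otimesZr.
Qed.

Definition tmapk : tensk A B -> tensk A' B' := tlin tmapk_bilin.
HB.instance Definition _ := GRing.Linear.on tmapk.

Lemma tmapkE a b : tmapk (a ⊗ b) = f a ⊗ g b.
Proof. exact: tlinE. Qed.

End Map.

Section Contract.
Variables (A B : lmodType k) (x : {scalar A}).

Fact contract_bilin : bilin (fun a (b : B) => x a *: b).
Proof.
split=> [b c a a'|a c b b'].
  by rewrite linearP scalerDl scalerA.
by rewrite scalerDr !scalerA mulrC.
Qed.

Definition contract : tensk A B -> B := tlin contract_bilin.
HB.instance Definition _ := GRing.Linear.on contract.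

Lemma contractE a b : contract (a ⊗ b) = x a *: b.
Proof. exact: tlinE. Qed.

End Contract.

Section Swap.
Variables A B : lmodType k.

Fact tswap_bilin : bilin (fun (a : A) (b : B) => b ⊗ a : tensk B A).
Proof.
by split=> [b c a a'|a c b b']; rewrite ?otimesDl ?otimesDr ?otimesZl ?otimesZr.
Qed.

Definition tswap : tensk A B -> tensk B A := tlin tswap_bilin.
HB.instance Definition _ := GRing.Linear.on tswap.

Lemma tswapE a b : tswap (a ⊗ b) = b ⊗ a.
Proof. exact: tlinE. Qed.

End Swap.

Section Product.
Variables (A A' A'' B B' B'' : lmodType k).
Variables (f : A -> A' -> A'') (g : B -> B' -> B'').
Hypotheses (fB : bilin f) (gB : bilin g).

Fact tmul2_bilinr a b : bilin (fun a' b' => f a a' ⊗ g b b' : tensk A'' B'').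
Proof.
split=> [b' c a' a''|a' c b' b''].
  by rewrite fB.2 otimesDl otimesZl.
by rewrite gB.2 otimesDr otimesZr.
Qed.

Fact tmul2_bilinl u : bilin (fun a b => tlin (tmul2_bilinr a b) u).
Proof.
split=> [b c a a'|a c b b']; elim/tensk_ind: u => [|t u IHt IHu|x y].
- by rewrite !raddf0 addr0.
- by rewrite !raddfD /= IHt IHu addrACA.
- by rewrite !tlinE fB.1 otimesDl otimesZl.
- by rewrite !raddf0 addr0.
- by rewrite !raddfD /= IHt IHu addrACA.
- by rewrite !tlinE gB.1 otimesDr otimesZr.
Qed.

(** Stated for two arbitrary bilinear maps: it serves for the twisted action of H as well as for
    products on H (x) R and H (x) A, whose second factors are not packaged as an [algType]. *)
Definition tmul2 (t : tensk A B) (u : tensk A' B') : tensk A'' B'' :=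
  tlin (tmul2_bilinl u) t.

Lemma tmul2E a b a' b' : tmul2 (a ⊗ b) (a' ⊗ b') = f a a' ⊗ g b b'.
Proof. by rewrite /tmul2 !tlinE. Qed.

Lemma tmul2_bilin : bilin tmul2.
Proof.
split=> [u c t t'|t c u u']; first exact: linearP.
elim/tensk_ind: t => [|t t' IHt IHt'|a b].
- by rewrite /tmul2 !raddf0 addr0.
- rewrite /tmul2 in IHt IHt' *.
  by rewrite !raddfD /= IHt IHt' addrACA.
- by rewrite /tmul2 !tlinE linearP.
Qed.

End Product.

Lemma tmapk_id (A B : lmodType k) (t : tensk A B) : tmapk idfun idfun t = t.
Proof.
elim/tensk_ind: t => [|t t' IHt IHt'|a b]; first by rewrite raddf0.
  by rewrite raddfD /= IHt IHt'.
by rewrite tmapkE.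
Qed.

Lemma tmapk_comp (A B A' B' A'' B'' : lmodType k) (f : {linear A -> A'})
    (f' : {linear A' -> A''}) (l : {linear B -> B'}) (l' : {linear B' -> B''}) t :
  tmapk f' l' (tmapk f l t) = tmapk (f' \o f) (l' \o l) t.
Proof.
elim/tensk_ind: t => [|t t' IHt IHt'|a b]; first by rewrite !raddf0.
  by rewrite !raddfD /= IHt IHt'.
by rewrite !tmapkE.
Qed.

Lemma eq_tmapk (A B A' B' : lmodType k) (f f' : {linear A -> A'})
    (l l' : {linear B -> B'}) :
  f =1 f' -> l =1 l' -> tmapk f l =1 tmapk f' l'.
Proof.
move=> ff' ll'; elim/tensk_ind => [|t t' IHt IHt'|a b]; first by rewrite !raddf0.
  by rewrite !raddfD /= IHt IHt'.
by rewrite !tmapkE ff' ll'.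
Qed.

Lemma tmapkM (A B A' B' : algType k) (f : {linear A -> A'}) (l : {linear B -> B'}) :
  {morph f : a b / a * b} -> {morph l : a b / a * b} ->
  {morph tmapk f l : t t' / t * t'}.
Proof.
move=> fM lM t t'; elim/tensk_ind: t => [|t u IHt IHu|a b].
- by rewrite mul0r !raddf0 mul0r.
- by rewrite mulrDl !raddfD /= IHt IHu mulrDl.
elim/tensk_ind: t' => [|t u IHt IHu|a' b'].
- by rewrite mulr0 !raddf0 mulr0.
- by rewrite mulrDr !raddfD /= IHt IHu mulrDr.
by rewrite otimesM !tmapkE otimesM fM lM.
Qed.

Lemma tensk_sum (A B : lmodType k) (t : tensk A B) :
  exists s : seq (A * B), t = \sum_(q <- s) q.1 ⊗ q.2.
Proof. exact: tensP. Qed.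

Section Pairing.
Variable V : lmodType k.
Implicit Types (x y : dual V) (u v : V) (c : k).

Lemma pairing_addl x y v : pairing (x + y) v = pairing x v + pairing y v.
Proof. by []. Qed.

Lemma pairing_oppl x v : pairing (- x) v = - pairing x v.
Proof. by []. Qed.

Lemma pairing_suml n (F : nat -> dual V) v :
  pairing (\sum_(i < n) F i) v = \sum_(i < n) pairing (F i) v.
Proof.
elim: n => [|n IHn]; first by rewrite !big_ord0.
by rewrite !big_ord_recr pairing_addl IHn.
Qed.

Lemma pairing_addr x u v : pairing x (u + v) = pairing x u + pairing x v.
Proof. exact: raddfD. Qed.

Lemma pairing_oppr x v : pairing x (- v) = - pairing x v.
Proof. exact: linearN. Qed.

Lemma pairing_scaler x c v : pairing x (c *: v) = c * pairing x v.
Proof. exact: linearZ. Qed.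

Lemma pairing_sumr x n (F : nat -> V) :
  pairing x (\sum_(i < n) F i) = \sum_(i < n) pairing x (F i).
Proof. exact: raddf_sum. Qed.

End Pairing.

(* A subspace maximal among those avoiding v is the kernel of the functional. *)
Lemma dual_separates (V : lmodType k) (v : V) :
  v != 0 -> exists x : dual V, pairing x v = 1.
Proof.
move=> v0.
pose S (W : set V) := (forall c u w, W u -> W w -> W (c *: u + w)) /\ ~ W v.
have [F FS Ftot|W [[Wlin Wv] Wmax]] := @Zorn_bigcup _ S.
  split=> [c u w [A FA Au] [B FB Bw]|[A FA]]; last by case: (FS _ FA).
  have [AB|BA] := Ftot _ _ FA FB.
    by exists B => //; apply: (FS _ FB).1 => //; apply: AB.
  by exists A => //; apply: (FS _ FA).1 => //; apply: BA.
(* The empty set also satisfies [S], so 0 in [W] has to be derived: an empty [W] would be properly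
   contained in {0}, which avoids [v]. *)
have W0 : W 0.
  apply: contrapT => nW0.
  have WE u : ~ W u.
    by move=> Wu; apply: nW0; rewrite -(addNr u) -scaleN1r; apply: Wlin.
  apply: (Wmax [set 0]); last by split=> [c u w -> ->|/eqP]; rewrite ?scaler0 ?addr0 ?(negPf v0).
  by split=> [u /WE|/(_ 0 erefl)].
have WZ c u : W u -> W (c *: u) by move=> Wu; rewrite -[_ *: _]addr0; apply: Wlin.
have WD u w : W u -> W w -> W (u + w) by move=> Wu; rewrite -[u in u + _]scale1r; apply: Wlin.
have WN u : W u -> W (- u) by rewrite -scaleN1r; apply: WZ.
(* [W] and [v] span the space: otherwise [W'], which is [W] enlarged by the line of [u], would still
   avoid [v] and contradict maximality. *)
have ex u : exists c, W (u - c *: v).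
  apply: contrapT => nex.
  pose W' := [set z | exists c, W (z - c *: u)].
  have nWu : ~ W u by move=> Wu; apply: nex; exists 0; rewrite scale0r subr0.
  apply: (Wmax W').
    split=> [w Ww|/(_ u)]; first by exists 0; rewrite scale0r subr0.
    by move=> /(_ _)/nWu; apply; exists 1; rewrite scale1r subrr.
  split=> [c z z' [a Wa] [b Wb]|[c Wc]].
    exists (c * a + b); have := WD _ _ (WZ c _ Wa) Wb.
    by rewrite scalerBr addrACA -opprD scalerA -scalerDl.
  have [c0|c0] := eqVneq c 0; first by apply: Wv; move: Wc; rewrite c0 scale0r subr0.
  apply: nex; exists c^-1; have := WN _ (WZ c^-1 _ Wc).
  by rewrite scalerBr scalerA mulVf // scale1r opprB.
pose f u := projT1 (cid (ex u)).
have fP u : W (u - f u *: v) := projT2 (cid (ex u)).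
have f_uniq u c : W (u - c *: v) -> f u = c.
  move=> Wc; apply/eqP; apply: contrapT => /negP; rewrite -subr_eq0 => fc.
  apply: Wv; have := WZ (f u - c)^-1 _ (WD _ _ Wc (WN _ (fP u))).
  by rewrite opprB [X in _ *: X]addrC addrA subrK -scalerBl scalerA mulVf // scale1r.
have fL : scalar f.
  move=> c u w; apply: f_uniq; have := WD _ _ (WZ c _ (fP u)) (fP w).
  by rewrite scalerBr addrACA -opprD scalerA -scalerDl.
by exists (mkdual fL); rewrite mkdualE; apply: f_uniq; rewrite scale1r subrr.
Qed.

(* Gaussian elimination on an arbitrary expression of t. *)
Lemma tensk_dual_rep (V W : lmodType k) (t : tensk V W) :
  exists n (v : nat -> V) (w : nat -> W) (x : nat -> dual V),
    t = \sum_(i < n) v i ⊗ w i /\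
    forall i j, (i < n)%N -> (j < n)%N -> pairing (x i) (v j) = (i == j)%:R.
Proof.
have [s ->] := tensk_sum t; elim: s => [|[g b] s [n [v [w [x [sE xv]]]]]].
  exists 0%N, (fun=> 0), (fun=> 0), (fun=> mkdual (@dual_zero_linear k V)).
  by rewrite big_nil big_ord0.
rewrite big_cons /= sE.
(* [h] is the part of [g] killed by every [x i]; the rest of [g ⊗ b] is absorbed into the right
   factors [w' i]. *)
pose h := g - \sum_(i < n) pairing (x i) g *: v i.
pose w' i := w i + pairing (x i) g *: b.
have -> : g ⊗ b + \sum_(i < n) v i ⊗ w i = \sum_(i < n) v i ⊗ w' i + h ⊗ b.
  rewrite -{1}[g](subrK (\sum_(i < n) pairing (x i) g *: v i)) -/h.
  rewrite otimesDl (bilin_suml (@otimes_bilin _ _ _)) -addrA addrC -big_split /=.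
  congr (_ + _); apply: eq_bigr => i _.
  by rewrite otimesDr otimesZr otimesZl addrC.
have xh i : (i < n)%N -> pairing (x i) h = 0.
  move=> ni; rewrite pairing_addr pairing_oppr.
  rewrite (pairing_sumr _ _ (fun j => pairing (x j) g *: v j)).
  rewrite (bigD1 (Ordinal ni)) //= big1 => [|j /negPf]; rewrite pairing_scaler.
    by rewrite xv // eqxx mulr1 addr0 subrr.
  by rewrite -val_eqE /= eq_sym xv // => ->; rewrite mulr0.
have [h0|/dual_separates[y yh]] := eqVneq h 0.
  by exists n, v, w', x; rewrite h0 (bilin0l (@otimes_bilin _ _ _)) addr0.
pose ext T (f : nat -> T) a i := if i == n then a else f i.
(* The correction makes the functional vanish on every [v i] and keeps its value 1 at [h], since the
   [x i] kill [h]. *)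
pose y' : dual V := y - \sum_(i < n) pairing y (v i) *: x i.
have y'E u : pairing y' u = pairing y u - \sum_(i < n) pairing y (v i) * pairing (x i) u.
  rewrite pairing_addl pairing_oppl.
  by rewrite (pairing_suml _ (fun i => pairing y (v i) *: x i)).
exists n.+1, (ext V v h), (ext W w' b), (ext (dual V) x y'); split.
  rewrite big_ord_recr /= /ext eqxx; congr (_ + _); apply: eq_bigr => i _.
  by rewrite ltn_eqF.
move=> i j; rewrite /ext !ltnS => ni nj.
have [-> {i ni}|ni'] := eqVneq i n; last first.
  have {ni ni'}ni : (i < n)%N by rewrite ltn_neqAle ni'.
  have [->|nj'] := eqVneq j n; first by rewrite xh // ltn_eqF.
  by rewrite xv // ltn_neqAle nj'.
have [_|nj'] := eqVneq j n.
  by rewrite y'E yh big1 ?subr0 // => i _; rewrite xh ?mulr0.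
have {nj nj'}nj : (j < n)%N by rewrite ltn_neqAle nj'.
rewrite y'E (bigD1 (Ordinal nj)) //= xv // eqxx mulr1 big1.
  by rewrite addr0 subrr.
by move=> i; rewrite -val_eqE /= => /negPf ij; rewrite xv // ij mulr0.
Qed.

(** Induction on the number of functionals. If [f n] vanishes on the common kernel of the earlier
    ones, it adds no condition; otherwise a vector [u] of that kernel with [f n u = 1] is added to
    the spanning family. *)
Lemma finite_codim_ker (V : lmodType k) n (f : nat -> V -> k) (J : set V) :
  (forall i, scalar (f i)) ->
  (forall v, (forall i, (i < n)%N -> f i v = 0) -> J v) -> finite_codim J.
Proof.
move=> fL; elim: n J => [|n IHn] J KJ.
  by exists [::] => v; exists (fun=> 0); apply: KJ.
have fZ i c u : f i (c *: u) = c * f i u.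
  exact: (pairing_scaler (mkdual (fL i))).
have fB i u w : f i (u - w) = f i u - f i w.
  have := pairing_addr (mkdual (fL i)) u (- w).
  by rewrite pairing_oppr !mkdualE.
have [[w [w0 wn]]|nw] := pselect (exists w, (forall i, (i < n)%N -> f i w = 0) /\ f n w != 0).
  pose u := (f n w)^-1 *: w.
  have un : f n u = 1 by rewrite fZ mulVf.
  have u0 i : (i < n)%N -> f i u = 0 by move=> ni; rewrite fZ (w0 i) ?mulr0.
  have [v v0|s sP] := IHn [set v | J (v - f n v *: u)].
    apply: KJ => i; rewrite ltnS leq_eqVlt => /orP[/eqP->|ni].
      by rewrite fB fZ un mulr1 subrr.
    by rewrite fB fZ u0 // mulr0 subr0 v0.
  exists (u :: s) => v; have [c Jc] := sP v.
  (* The coefficient of the new vector [u] is the value of [f n] on the remainder, exactly the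
     multiple of [u] removed in the set given to the induction hypothesis. *)
  pose a (i : 'I_(size s).+1) := if unlift ord0 i is Some j then c j
    else f n (v - \sum_(i < size s) c i *: s`_i).
  exists a; change (J (v - \sum_(i < (size s).+1) a i *: (u :: s)`_i)).
  have aS i : a (lift ord0 i) = c i by rewrite /a liftK.
  rewrite big_ord_recl /= (eq_bigr (fun i : 'I_(size s) => c i *: s`_i)); last first.
    by move=> i _; rewrite aS.
  rewrite {1}/a unlift_none.
  by rewrite opprD addrA addrAC.
apply: IHn => v v0; apply: KJ => i; rewrite ltnS leq_eqVlt => /orP[/eqP->|/v0//].
by apply/eqP; apply: contrapT => /negP vn; apply: nw; exists v.
Qed.

End LinearTensor.

(** * Hopf algebra identities of U(g) *)

Section HopfTheory.
Variables (k : fieldType) (g : lmodType k) (br : g -> g -> g).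

Local Notation H := (uenv br).
Local Notation H2 := (tensk H H).
Local Notation H3 := (tensk H2 H).
Implicit Types (x : g) (f h u v : H) (t w : H2).

HB.instance Definition _ := GRing.isLinear.Build k H k *%R
  (@counit k g br) (@counit_linear k g br).
HB.instance Definition _ := GRing.isLinear.Build k H H2 *:%R
  (@coprod k g br) (ueval_linear (coprod_gen_lie br)).

Fact antipode_linear : linear (@antipode k g br).
Proof. exact: (ueval_linear (antipode_gen_lie br)). Qed.

HB.instance Definition _ := GRing.isLinear.Build k H H *:%R
  (@antipode k g br) antipode_linear.

Lemma counit_gen x : counit (ugen br x) = 0.
Proof. exact: (ueval_gen (uconst0_lie br)). Qed.

Lemma coprod1 : coprod (1 : H) = 1.
Proof. exact: (ueval1 (coprod_gen_lie br)). Qed.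

Lemma coprodM : {morph (@coprod k g br) : u v / u * v}.
Proof. exact: (uevalM (coprod_gen_lie br)). Qed.

Lemma coprod_ugen x : coprod (ugen br x) = ugen br x ⊗ 1 + 1 ⊗ ugen br x.
Proof. exact: (ueval_gen (coprod_gen_lie br)). Qed.

Lemma antipode1 : antipode (1 : H) = 1.
Proof. exact: (ueval1 (antipode_gen_lie br)). Qed.

Lemma antipodeM u v : antipode (u * v) = antipode v * antipode u.
Proof. exact: (uevalM (antipode_gen_lie br)). Qed.

Lemma antipode_ugen x : antipode (ugen br x) = - ugen br x.
Proof. exact: (ueval_gen (antipode_gen_lie br)). Qed.

Lemma uenv_lin_ind (Q : H -> Prop) :
    Q 1 -> (forall x, Q (ugen br x)) -> (forall (c : k) u, Q u -> Q (c *: u)) ->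
    (forall u v, Q u -> Q v -> Q (u + v)) ->
    (forall u v, Q u -> Q v -> Q (u * v)) ->
  forall u, Q u.
Proof. by move=> Q1 Qg QZ QD QM; apply: uenv_ind => // c; apply: QZ. Qed.

(** Both sides are linear and multiplicative in [h], so the generators decide; for a product, the
    two coproducts are expanded into pure tensors. *)
Lemma counit_coprodl h : contract (@counit k g br) (coprod h) = h.
Proof.
elim/uenv_lin_ind: h => [|x|c u IH|u v IHu IHv|u v].
- by rewrite coprod1 contractE /= counit1 scale1r.
- by rewrite coprod_ugen raddfD /= !contractE /= counit1 counit_gen scale1r scale0r add0r.
- by rewrite !linearZ /= IH.
- by rewrite !raddfD /= IHu IHv.
move=> IHu IHv; rewrite coprodM -[in RHS]IHu -[in RHS]IHv.
elim/tensk_ind: (coprod u) => [|t t' IHt IHt'|a b].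
- by rewrite mul0r raddf0 mul0r.
- by rewrite mulrDl !raddfD /= IHt IHt' mulrDl.
elim/tensk_ind: (coprod v) => [|t t' IHt IHt'|a' b'].
- by rewrite mulr0 raddf0 mulr0.
- by rewrite mulrDr !raddfD /= IHt IHt' mulrDr.
by rewrite otimesM !contractE /= counitM -scalerAl -scalerAr scalerA.
Qed.

(** Cocommutativity, because the generators are primitive. It turns [counit_coprodl] into the counit
    identity for the other factor. *)
Lemma coprod_swap h : tswap (coprod h) = coprod h.
Proof.
elim/uenv_lin_ind: h => [|x|c u IH|u v IHu IHv|u v].
- by rewrite coprod1 tswapE.
- by rewrite coprod_ugen raddfD /= !tswapE addrC.
- by rewrite !linearZ /= IH.
- by rewrite !raddfD /= IHu IHv.
move=> IHu IHv; rewrite coprodM -[in RHS]IHu -[in RHS]IHv.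
elim/tensk_ind: (coprod u) => [|t t' IHt IHt'|a b].
- by rewrite mul0r raddf0 mul0r.
- by rewrite mulrDl !raddfD /= IHt IHt' mulrDl.
elim/tensk_ind: (coprod v) => [|t t' IHt IHt'|a' b'].
- by rewrite mulr0 raddf0 mulr0.
- by rewrite mulrDr !raddfD /= IHt IHt' mulrDr.
by rewrite otimesM !tswapE otimesM.
Qed.

(** Both sides reverse products and agree on generators. A general Hopf algebra has a flip here;
    cocommutativity removes it. *)
Lemma coprod_antipode h :
  coprod (antipode h) = tmapk (@antipode k g br) (@antipode k g br) (coprod h).
Proof.
elim/uenv_lin_ind: h => [|x|c u IH|u v IHu IHv|u v IHu IHv].
- by rewrite antipode1 coprod1 tmapkE /= antipode1.
- rewrite antipode_ugen linearN /= coprod_ugen opprD [in RHS]raddfD /= !tmapkE /= antipode1.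
  by rewrite antipode_ugen -!scaleN1r otimesZl otimesZr.
- by rewrite !linearZ /= IH.
- by rewrite !raddfD /= IHu IHv.
rewrite antipodeM !coprodM IHu IHv.
elim/tensk_ind: (coprod u) => [|t t' IHt IHt'|a b].
- by rewrite mul0r raddf0 mulr0.
- by rewrite mulrDl !raddfD /= mulrDr IHt IHt'.
elim/tensk_ind: (coprod v) => [|t t' IHt IHt'|a' b'].
- by rewrite mulr0 raddf0 mul0r.
- by rewrite mulrDr !raddfD /= mulrDl IHt IHt'.
by rewrite otimesM !tmapkE /= otimesM !antipodeM.
Qed.

Fact mul_antipode_bilin : bilin (fun u v : H => u * antipode v).
Proof.
split=> [v c u u'|u c v v']; first by rewrite mulrDl -scalerAl.
by rewrite linearP mulrDr -scalerAr.
Qed.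

(** This is h_1 S(h_2) = counit(h). For a product, in u_1 v_1 S(v_2) S(u_2) the inner pair collapses
    to the scalar counit(v), which moves out and leaves the case of [u]. *)
Lemma mul_antipode_coprod h : tlin mul_antipode_bilin (coprod h) = counit h *: 1.
Proof.
elim/uenv_lin_ind: h => [|x|c u IH|u v IHu IHv|u v IHu IHv].
- by rewrite coprod1 tlinE antipode1 mulr1 counit1 scale1r.
- rewrite coprod_ugen raddfD /= !tlinE antipode1 antipode_ugen mulr1 mul1r.
  by rewrite subrr counit_gen scale0r.
- by rewrite !linearZ /= IH scalerA.
- by rewrite !raddfD /= IHu IHv scalerDl.
rewrite coprodM counitM.
have -> : (counit u * counit v) *: (1 : H) = counit v *: tlin mul_antipode_bilin (coprod u).
  by rewrite IHu scalerA mulrC.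
elim/tensk_ind: (coprod u) => [|t t' IHt IHt'|a b].
- by rewrite mul0r !raddf0.
- by rewrite mulrDl !raddfD /= IHt IHt'.
have -> : counit v *: tlin mul_antipode_bilin (a ⊗ b) =
          a * tlin mul_antipode_bilin (coprod v) * antipode b.
  by rewrite IHv !tlinE -scalerAr -scalerAl mulr1.
elim/tensk_ind: (coprod v) => [|t t' IHt IHt'|a' b'].
- by rewrite mulr0 raddf0 mulr0 mul0r.
- by rewrite mulrDr !raddfD /= mulrDr mulrDl IHt IHt'.
by rewrite otimesM !tlinE antipodeM !mulrA.
Qed.

Lemma coprod_idE t : coprod_id t = tmapk (@coprod k g br) idfun t.
Proof. by []. Qed.

Fact id_coprod_bilinr f : bilin (fun h1 h2 : H => (f ⊗ h1 : H2) ⊗ h2 : H3).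
Proof.
split=> [b c a a'|a c b b'].
  by rewrite otimesDr otimesDl otimesZr otimesZl.
by rewrite otimesDr otimesZr.
Qed.

Fact id_coprod_bilinl : bilin (fun f h : H => tlin (id_coprod_bilinr f) (coprod h)).
Proof.
split=> [h c f f'|f c h h']; last by rewrite !linearP.
elim/tensk_ind: (coprod h) => [|t t' IHt IHt'|a b].
- by rewrite !raddf0 addr0.
- by rewrite !raddfD /= IHt IHt' addrACA.
by rewrite !tlinE otimesDl otimesZl otimesDl otimesZl.
Qed.

Lemma id_coprodE t : id_coprod t = tlin id_coprod_bilinl t.
Proof. by []. Qed.

Lemma id_coprod_pure f h : id_coprod (f ⊗ h) = tlin (id_coprod_bilinr f) (coprod h).
Proof. by rewrite id_coprodE tlinE. Qed.

Fact one_otimes_bilin : bilin (fun f h : H => (1 ⊗ f : H2) ⊗ h : H3).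
Proof.
split=> [b c a a'|a c b b'].
  by rewrite otimesDr otimesDl otimesZr otimesZl.
by rewrite otimesDr otimesZr.
Qed.

Lemma one_otimesE t : one_otimes t = tlin one_otimes_bilin t.
Proof. by []. Qed.

Lemma one_otimes_pure f h : one_otimes (f ⊗ h) = (1 ⊗ f) ⊗ h.
Proof. by rewrite one_otimesE tlinE. Qed.

Lemma coprod_idM : {morph (@coprod_id k g br) : t w / t * w}.
Proof. by move=> t w; rewrite !coprod_idE (tmapkM coprodM). Qed.

Lemma one_otimesM : {morph (@one_otimes k g br) : t w / t * w}.
Proof.
move=> t w; rewrite !one_otimesE; elim/tensk_ind: t => [|t t' IHt IHt'|a b].
- by rewrite mul0r !raddf0 mul0r.
- by rewrite mulrDl !raddfD /= IHt IHt' mulrDl.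
elim/tensk_ind: w => [|t t' IHt IHt'|a' b'].
- by rewrite mulr0 !raddf0 mulr0.
- by rewrite mulrDr !raddfD /= IHt IHt' mulrDr.
by rewrite otimesM !tlinE !otimesM mulr1.
Qed.

Lemma id_coprodM : {morph (@id_coprod k g br) : t w / t * w}.
Proof.
move=> t w; rewrite !id_coprodE; elim/tensk_ind: t => [|t t' IHt IHt'|a b].
- by rewrite mul0r !raddf0 mul0r.
- by rewrite mulrDl !raddfD /= IHt IHt' mulrDl.
elim/tensk_ind: w => [|t t' IHt IHt'|a' b'].
- by rewrite mulr0 !raddf0 mulr0.
- by rewrite mulrDr !raddfD /= IHt IHt' mulrDr.
rewrite otimesM !tlinE coprodM.
elim/tensk_ind: (coprod b) => [|t t' IHt IHt'|c d].
- by rewrite mul0r !raddf0 mul0r.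
- by rewrite mulrDl !raddfD /= IHt IHt' mulrDl.
elim/tensk_ind: (coprod b') => [|t t' IHt IHt'|c' d'].
- by rewrite mulr0 !raddf0 mulr0.
- by rewrite mulrDr !raddfD /= IHt IHt' mulrDr.
by rewrite otimesM !tlinE !otimesM.
Qed.

(** Both sides are algebra morphisms from H to its third tensor power, and they agree on the
    primitive generators. *)
Lemma coprod_coassoc h : coprod_id (coprod h) = id_coprod (coprod h).
Proof.
elim/uenv_lin_ind: h => [|x|c u IH|u v IHu IHv|u v IHu IHv].
- have e11 : (1 : H2) = 1 ⊗ 1 by [].
  by rewrite coprod1 {1 2}e11 coprod_idE tmapkE id_coprod_pure /= coprod1 {2}e11 tlinE.
- rewrite coprod_ugen coprod_idE id_coprodE !raddfD /= !tmapkE !tlinE.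
  rewrite /= coprod1 coprod_ugen otimesDl [in RHS]raddfD /= !tlinE.
  by rewrite addrA.
- by rewrite coprod_idE id_coprodE !linearZ /= -coprod_idE -id_coprodE IH.
- rewrite coprod_idE id_coprodE !raddfD /= -!coprod_idE -!id_coprodE.
  by rewrite IHu IHv.
by rewrite coprodM coprod_idM id_coprodM IHu IHv.
Qed.

Lemma id_coprod_one_otimes h : id_coprod (1 ⊗ h) = one_otimes (coprod h).
Proof. by rewrite id_coprod_pure one_otimesE; congr (tlin _ _); apply: Prop_irrelevance. Qed.

End HopfTheory.

(** * Untwisting (H (x) H) (x)_H R and its analogue with three factors *)

Section Untwisting.
Variables (k : fieldType) (g : lmodType k) (br : g -> g -> g).

Local Notation H := (uenv br).
Local Notation H2 := (tensk H H).
Local Notation H3 := (tensk H2 H).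

(** An alias of [R], so that the vector space structure restricted along c |-> c 1 stays apart from
    the structure of H-module. *)
Definition krestr (R : lmodType H) : Type := R.

Section Restriction.
Variable R : lmodType H.

HB.instance Definition _ := GRing.Zmodule.on (krestr R).

Definition hact (h : H) (r : krestr R) : krestr R := h *: (r : R).
Definition krestr_scale (c : k) (r : krestr R) : krestr R := hact c%:A r.

Fact krestr_scaleA c d r : krestr_scale c (krestr_scale d r) = krestr_scale (c * d) r.
Proof. by rewrite /krestr_scale /hact scalerA mulr_algl scalerA. Qed.
Fact krestr_scale1 : left_id 1 krestr_scale.
Proof. by move=> r; rewrite /krestr_scale /hact !scale1r. Qed.
Fact krestr_scaleDr : right_distributive krestr_scale +%R.
Proof. by move=> c r s; exact: scalerDr. Qed.
Fact krestr_scaleDl r : {morph krestr_scale^~ r : c d / c + d}.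
Proof. by move=> c d; rewrite /krestr_scale scalerDl; apply: scalerDl. Qed.

HB.instance Definition _ := GRing.Zmodule_isLmodule.Build k (krestr R)
  krestr_scaleA krestr_scale1 krestr_scaleDr krestr_scaleDl.

Lemma krestr_scaleE c (r : krestr R) : c *: r = hact c%:A r.
Proof. by []. Qed.

Lemma hact1 r : hact 1 r = r.
Proof. by rewrite /hact scale1r. Qed.

Lemma hactM h h' r : hact (h * h') r = hact h (hact h' r).
Proof. by rewrite /hact scalerA. Qed.

Lemma hact_bilin : bilin hact.
Proof.
split=> [r c h h'|h c r r'].
  by rewrite krestr_scaleE -hactM mulr_algl /hact scalerDl.
rewrite !krestr_scaleE -hactM (_ : c%:A * h = h * c%:A); last by rewrite mulr_algl mulr_algr.
by rewrite (hactM h) /hact scalerDr.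
Qed.

End Restriction.

Section Twist.
Variables (K : algType k) (theta : {linear H -> K}).
Hypotheses (theta1 : theta 1 = 1) (thetaM : {morph theta : u v / u * v}).
Variable R : lmodType H.

Local Notation V := (krestr R).

Fact twist_bilin : bilin (fun (h : H) (t : K) => t * theta (antipode h)).
Proof.
split=> [t c h h'|h c t t']; first by rewrite !linearP mulrDr -scalerAr.
by rewrite mulrDl -scalerAl.
Qed.

(** [theta] is the identity for two factors of H and the coproduct for three. The action is first
    defined for all of H (x) H, where its multiplicativity can be checked on pure tensors; [twist]
    then restricts it along the coproduct. *)
Definition twist2 := tmul2 twist_bilin (@hact_bilin R).

Lemma twist2_bilin : bilin twist2.
Proof. exact: tmul2_bilin. Qed.

Lemma twist2M (t u : H2) z : twist2 (t * u) z = twist2 t (twist2 u z).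
Proof.
elim/tensk_ind: t => [|t t' IHt IHt'|a b].
- by rewrite mul0r !(bilin0l twist2_bilin).
- by rewrite mulrDl !(bilinDl twist2_bilin) IHt IHt'.
elim/tensk_ind: u => [|t t' IHt IHt'|a' b'].
- by rewrite mulr0 !(bilin0l twist2_bilin) (bilin0r twist2_bilin).
- by rewrite mulrDr !(bilinDl twist2_bilin) (bilinDr twist2_bilin) IHt IHt'.
elim/tensk_ind: z => [|t t' IHt IHt'|s r].
- by rewrite !(bilin0r twist2_bilin).
- by rewrite !(bilinDr twist2_bilin) IHt IHt'.
by rewrite otimesM /twist2 !tmul2E antipodeM thetaM mulrA hactM.
Qed.

(* The action of H on K (x) R given by t (x) r |-> t theta(S(h_1)) (x) h_2 r. *)
Definition twist (h : H) (z : tensk K V) : tensk K V := twist2 (coprod h) z.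

Lemma twist_bilin2 : bilin twist.
Proof.
split=> [z c h h'|h c z z']; last exact: twist2_bilin.2.
by rewrite /twist linearP twist2_bilin.1.
Qed.

Lemma twistM u v z : twist (u * v) z = twist u (twist v z).
Proof. by rewrite /twist coprodM twist2M. Qed.

Lemma twist1 z : twist 1 z = z.
Proof.
elim/tensk_ind: z => [|t t' IHt IHt'|s r].
- by rewrite (bilin0r twist_bilin2).
- by rewrite (bilinDr twist_bilin2) IHt IHt'.
by rewrite /twist coprod1 /twist2 tmul2E antipode1 theta1 mulr1 hact1.
Qed.

Lemma twist_ugen x t r :
  twist (ugen br x) (t ⊗ r) = t ⊗ hact (ugen br x) r - (t * theta (ugen br x)) ⊗ r.
Proof.
rewrite /twist coprod_ugen (bilinDl twist2_bilin) /twist2 !tmul2E antipode1.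
rewrite antipode_ugen linearN theta1 mulr1 hact1 mulrN addrC; congr (_ + _).
by rewrite -scaleN1r otimesZl scaleN1r.
Qed.

Fact untwist_bilinl (r : V) : bilin (fun t (h : H) => twist h (t ⊗ r)).
Proof.
split=> [h c t t'|t c h h']; last exact: twist_bilin2.1.
by rewrite otimesDl otimesZl twist_bilin2.2.
Qed.

(* The untwisting isomorphism (K (x) H) (x)_H R -> K (x) R, whose inverse is
   t (x) r |-> (t (x) 1) (x)_H r. *)
Definition untwist (w : tensk K H) (r : V) : tensk K V := tlin (untwist_bilinl r) w.

Lemma untwistE t h r : untwist (t ⊗ h) r = twist h (t ⊗ r).
Proof. exact: tlinE. Qed.

Lemma untwist_bilin : bilin untwist.
Proof.
split=> [r c w w'|w c r r']; first exact: linearP.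
elim/tensk_ind: w => [|w w' IHw IHw'|t h].
- by rewrite /untwist !raddf0 addr0.
- by rewrite /untwist !raddfD /= -!/(untwist _ _) IHw IHw' addrACA.
by rewrite !untwistE otimesDr otimesZr twist_bilin2.2.
Qed.

(** The property passes to products in [h]. For a generator x, the term t theta(x) (x) r coming from
    the left factor cancels the negative term in [twist_ugen], which leaves t (x) x r. *)
Lemma untwist_balanced w h r :
  untwist (w * tmapk theta idfun (coprod h)) r = untwist w (hact h r).
Proof.
have idM : {morph (idfun : {linear H -> H}) : u v / u * v} by [].
elim/uenv_lin_ind: h w r => [|x|c u IH|u v IHu IHv|u v IHu IHv] w r.
- by rewrite coprod1 tmapkE theta1 mulr1 hact1.
- rewrite coprod_ugen raddfD /= !tmapkE theta1 /=.
  elim/tensk_ind: w => [|w w' IHw IHw'|t h].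
  + by rewrite mul0r !(bilin0l untwist_bilin).
  + by rewrite mulrDl !(bilinDl untwist_bilin) IHw IHw'.
  rewrite mulrDr (bilinDl untwist_bilin) !otimesM !mulr1 !untwistE.
  rewrite twistM twist_ugen -(bilinDr twist_bilin2); congr (twist _ _).
  by rewrite addrC subrK.
- rewrite !linearZ /= [w * _]tensk_mulZr (bilinZl untwist_bilin) IH.
  by rewrite (bilinZl (hact_bilin R)) (bilinZr untwist_bilin).
- rewrite !raddfD /= mulrDr (bilinDl untwist_bilin) IHu IHv.
  by rewrite (bilinDl (hact_bilin R)) (bilinDr untwist_bilin).
by rewrite coprodM (tmapkM thetaM idM) mulrA IHv IHu hactM.
Qed.

End Twist.

Section Kappa.
Variable R : lmodType H.
Local Notation V := (krestr R).

Let id1 : (idfun : {linear H -> H}) 1 = 1. Proof. by []. Qed.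
Let idM : {morph (idfun : {linear H -> H}) : u v / u * v}. Proof. by []. Qed.

Definition kappa2 (z : htens2 R) : tensk H V := tlift (untwist (@idfun H) (R := R)) z.
Definition kappa3 (z : htens3 R) : tensk H2 V :=
  tlift (untwist (@coprod k g br) (R := R)) z.

Lemma kappa2_balanced : balanced (@ract2 k g br) (fun h (r : R) => h *: r)
  (untwist (@idfun H) (R := R)).
Proof.
split=> [r w w'|w r r'|w h r].
- exact: (bilinDl (untwist_bilin _ _)).
- exact: (bilinDr (untwist_bilin _ _)).
by rewrite -(untwist_balanced id1 idM) tmapk_id.
Qed.

Lemma kappa3_balanced : balanced (@ract3 k g br) (fun h (r : R) => h *: r)
  (untwist (@coprod k g br) (R := R)).
Proof.
split=> [r w w'|w r r'|w h r].
- exact: (bilinDl (untwist_bilin _ _)).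
- exact: (bilinDr (untwist_bilin _ _)).
by rewrite -(untwist_balanced (coprod1 br) (@coprodM _ _ br)).
Qed.

Lemma kappa2D : {morph kappa2 : z z' / z + z'}.
Proof. exact: (tliftD kappa2_balanced). Qed.

Lemma kappa20 : kappa2 0 = 0.
Proof. exact: (tlift0 kappa2_balanced). Qed.

Lemma kappa2E t h (r : R) : kappa2 (hpure2 (t ⊗ h) r) = twist idfun h (t ⊗ (r : V)).
Proof. by rewrite [LHS](tliftE kappa2_balanced) untwistE. Qed.

Lemma kappa2_1 t (r : R) : kappa2 (hpure2 (t ⊗ 1) r) = t ⊗ (r : V).
Proof. by rewrite kappa2E (twist1 id1). Qed.

Lemma kappa3D : {morph kappa3 : z z' / z + z'}.
Proof. exact: (tliftD kappa3_balanced). Qed.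

Lemma kappa30 : kappa3 0 = 0.
Proof. exact: (tlift0 kappa3_balanced). Qed.

Lemma kappa3_1 (t : H2) (r : R) : kappa3 (tpure _ _ (t ⊗ 1) r) = t ⊗ (r : V).
Proof. by rewrite [LHS](tliftE kappa3_balanced) untwistE (twist1 (coprod1 br)). Qed.

Lemma lact2_balanced (u : H2) : balanced (@ract2 k g br) (fun h (r : R) => h *: r)
  (fun t (r : R) => hpure2 (u * t) r).
Proof.
split=> [r t t'|t r r'|t h r].
- by rewrite mulrDr; apply: tpureDl.
- exact: tpureDr.
by rewrite /ract2 mulrA; apply: tpure_bal.
Qed.

Lemma lact2E u t (r : R) : lact2 u (hpure2 t r) = hpure2 (u * t) r.
Proof. exact: (tliftE (lact2_balanced u)). Qed.

Lemma lact2D u : {morph @lact2 _ _ _ R u : z z' / z + z'}.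
Proof. exact: (tliftD (lact2_balanced u)). Qed.

Lemma lact20 u : @lact2 _ _ _ R u 0 = 0.
Proof. exact: (tlift0 (lact2_balanced u)). Qed.

(** Balancing clears the second factor: for a generator x, (f (x) x) (x)_H r = (f (x) 1) (x)_H x r -
    (f x (x) 1) (x)_H r. *)
Lemma htens2_ind (Q : htens2 R -> Prop) :
    Q 0 -> (forall z z', Q z -> Q z' -> Q (z + z')) ->
    (forall f r, Q (hpure2 (f ⊗ 1) r)) ->
  forall z, Q z.
Proof.
move=> Q0 QD Q1; apply: tens_ind => //; move=> t r; rewrite -/(hpure2 t r).
elim/tensk_ind: t r => [|t t' IHt IHt'|f h] r.
- by rewrite (_ : hpure2 0 r = 0) //; apply: (balanced0 (tpure_balanced _ _)).
- by rewrite (_ : hpure2 (t + t') r = hpure2 t r + hpure2 t' r) //; [apply: QD|apply: tpureDl].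
(* The given [Q] need not be stable under the left action of 1 (x) u, which the case of products
   requires; the span of the generators, as the least such predicate, is. *)
pose Span (z : htens2 R) := forall Q : htens2 R -> Prop, Q 0 ->
  (forall z z', Q z -> Q z' -> Q (z + z')) ->
  (forall f r, Q (hpure2 (f ⊗ 1) r)) -> Q z.
suff SP : Span (hpure2 (f ⊗ h) r) by apply: SP.
have S0 : Span 0 by [].
have SD z z' : Span z -> Span z' -> Span (z + z').
  by move=> Sz Sz' Q' Q'0 Q'D Q'1; apply: (Q'D); [apply: Sz|apply: Sz'].
elim/uenv_lin_ind: h f r => [|x|c u IH|u v IHu IHv|u v IHu IHv] f r.
- by move=> Q' _ _; apply.
- have -> : hpure2 (f ⊗ ugen br x) r =
      hpure2 (f ⊗ 1) (ugen br x *: r) + hpure2 ((- (f * ugen br x)) ⊗ 1) r.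
    rewrite -[hpure2 _ (_ *: _)]tpure_bal -[RHS]tpureDl; congr (tpure _ _ _ _).
    rewrite /ract2 coprod_ugen mulrDr !otimesM !mulr1 mul1r.
    by rewrite -scaleN1r otimesZl scaleN1r addrC addKr.
  by apply: SD => Q' _ _; apply.
- by rewrite otimesZr -otimesZl; apply: IH.
- rewrite (_ : hpure2 _ r = hpure2 (f ⊗ u) r + hpure2 (f ⊗ v) r).
    exact: SD.
  by rewrite otimesDr; apply: tpureDl.
have -> : hpure2 (f ⊗ (u * v)) r = lact2 (1 ⊗ u) (hpure2 (f ⊗ v) r).
  by rewrite lact2E otimesM mul1r.
apply: (IHv f r (fun z => Span (lact2 (1 ⊗ u) z))).
- by rewrite lact20.
- by move=> z z' Sz Sz'; rewrite lact2D; apply: SD.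
by move=> f' r'; rewrite lact2E otimesM mul1r mulr1; apply: IHu.
Qed.

Fact unkappa_balanced : balanced (fun (t : H) (c : k) => c *: t) (fun c (r : V) => c *: r)
  (fun (t : H) (r : V) => hpure2 (t ⊗ 1) (r : R)).
Proof.
split=> [r t t'|t r r'|t c r].
- by rewrite otimesDl; apply: tpureDl.
- exact: tpureDr.
rewrite krestr_scaleE -[RHS]tpure_bal; congr (tpure _ _ _ _).
by rewrite /ract2 linearZ /= coprod1 [RHS]tensk_mulZr otimesZl; congr (_ *: _); apply: (esym (mulr1 _)).
Qed.

Lemma kappa2_inj : injective kappa2.
Proof.
pose unkappa (z : tensk H V) : htens2 R := tlift (fun (t : H) (r : V) => hpure2 (t ⊗ 1) (r : R)) z.
have uD : {morph unkappa : z z' / z + z'} by exact: (tliftD unkappa_balanced).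
suff kK : cancel kappa2 unkappa by apply: can_inj kK.
elim/htens2_ind => [|z z' IHz IHz'|f r].
- by rewrite kappa20 /unkappa (tlift0 unkappa_balanced).
- by rewrite kappa2D uD IHz IHz'.
by rewrite kappa2_1 /unkappa (tliftE unkappa_balanced).
Qed.

(** The element S(x) of X, as a linear form to be used in [contract]. *)
Definition antipodal (x : dual H) : H -> k := (x : {scalar H}) \o @antipode k g br.
HB.instance Definition _ x := GRing.Linear.on (antipodal x).

(** [kappa2] sends every expression sum (f_i (x) 1) (x)_H e_i to sum f_i (x) e_i, so the one picked
    by [xget] does not matter; [htens2_ind] provides one, which rules out the default value. *)
Lemma xprodE (p : pprod R) x (a b : R) :
  xprod p x a b = contract (antipodal x) (kappa2 (p a b)).
Proof.
rewrite /xprod; set S := [set s | _].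
have kS s : S s -> \sum_(q <- s) (pairing x (antipode q.1))%:A *: q.2 =
                   contract (antipodal x) (kappa2 (p a b)).
  move=> ->; elim: s => [|q s IHs]; first by rewrite !big_nil kappa20 raddf0.
  by rewrite !big_cons kappa2D raddfD /= IHs kappa2_1 contractE.
apply: kS; case: xgetP => // nS; exfalso.
have [s ps] : exists s, p a b = \sum_(q <- s) hpure2 (q.1 ⊗ 1) q.2.
  elim/htens2_ind: (p a b) => [|z z' [s ->] [s' ->]|f r].
  - by exists [::]; rewrite big_nil.
  - by exists (s ++ s'); rewrite big_cat.
  by exists [:: (f, r)]; rewrite big_seq1.
exact: (nS s).
Qed.

End Kappa.

Section Functoriality.
Variables (R R' : lmodType H) (phi : {linear R -> R'}).

Local Notation htmap := (tmap (fun t : H2 => t) phi : htens2 R -> htens2 R').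

Fact htmap_balanced : balanced (@ract2 k g br) (fun h (r : R) => h *: r)
  (fun t (r : R) => hpure2 t (phi r)).
Proof.
split=> [r t t'|t r r'|t h r]; first exact: tpureDl.
  by rewrite raddfD; apply: tpureDr.
by rewrite linearZ; apply: tpure_bal.
Qed.

Lemma htmapE t r : htmap (hpure2 t r) = hpure2 t (phi r).
Proof. exact: (tliftE htmap_balanced). Qed.

Lemma htmap0 : htmap 0 = 0.
Proof. exact: (tlift0 htmap_balanced). Qed.

Lemma htmapD : {morph htmap : z z' / z + z'}.
Proof. exact: (tliftD htmap_balanced). Qed.

Lemma htmap_lact2 u z : htmap (lact2 u z) = lact2 u (htmap z).
Proof.
elim/htens2_ind: z => [|z z' IHz IHz'|f v]; first by rewrite htmap0 !lact20 htmap0.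
  by rewrite htmapD !lact2D htmapD IHz IHz'.
by rewrite htmapE !lact2E htmapE.
Qed.

Lemma contract_htmap (x : {scalar H}) z :
  contract x (kappa2 (htmap z)) = phi (contract x (kappa2 z)).
Proof.
elim/htens2_ind: z => [|z z' IHz IHz'|f v].
- by rewrite htmap0 !kappa20 !raddf0.
- rewrite htmapD !kappa2D raddfD /= IHz IHz' [in RHS]raddfD /=.
  exact: (esym (raddfD phi _ _)).
by rewrite htmapE !kappa2_1 !contractE; exact: (esym (linearZZ phi (x f)%:A v)).
Qed.

End Functoriality.

End Untwisting.

(** * Pseudoproducts and associativity in untwisted form *)

Section Pseudoproducts.
Variables (k : fieldType) (g : lmodType k) (br : g -> g -> g).

Local Notation H := (uenv br).
Local Notation H2 := (tensk H H).
Local Notation H3 := (tensk H2 H).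

Definition lmulk (A : algType k) (a : A) : A -> A := fun b => a * b.
Fact lmulk_linear (A : algType k) (a : A) : linear (lmulk a).
Proof. by move=> c u v; rewrite /lmulk mulrDr -scalerAr. Qed.
HB.instance Definition _ (A : algType k) (a : A) :=
  GRing.isLinear.Build k A A *:%R (lmulk a) (lmulk_linear a).

Definition otimesl (A B : lmodType k) (b : B) : A -> tensk A B := fun a => a ⊗ b.
Fact otimesl_linear (A B : lmodType k) (b : B) : linear (@otimesl A B b).
Proof. by move=> c u v; rewrite /otimesl otimesDl otimesZl. Qed.
HB.instance Definition _ (A B : lmodType k) (b : B) :=
  GRing.isLinear.Build k A (tensk A B) *:%R (@otimesl A B b) (otimesl_linear b).

Definition lcoprod (f : H) : H -> H2 := lmulk (f ⊗ 1 : H2) \o @coprod k g br.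
HB.instance Definition _ f := GRing.Linear.on (lcoprod f).

Lemma lcoprodP d h h' f : lcoprod (d *: h + h') f = d *: lcoprod h f + lcoprod h' f.
Proof.
by rewrite /lcoprod /= /lmulk otimesDl otimesZl mulrDl [X in X + _]tensk_mulZl.
Qed.

Variables (R : lmodType H) (p : pprod R).
Local Notation V := (krestr R).
Hypothesis pP : pseudoproduct p.

Definition dprod (r s : V) : tensk H V := kappa2 (p r s).

Lemma dprod_hactl h r s : dprod (hact h r) s = tmapk (lmulk h) idfun (dprod r s).
Proof.
have [_ _ /(_ h 1 r s)] := pP; rewrite scale1r /dprod /hact => ->.
elim/htens2_ind: (p r s) => [|z z' IHz IHz'|f v].
- by rewrite lact20 kappa20 raddf0.
- by rewrite lact2D !kappa2D raddfD /= IHz IHz'.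
by rewrite lact2E otimesM mulr1 !kappa2_1 tmapkE.
Qed.

Lemma dprod_hactr h r s : dprod r (hact h s) = twist idfun h (dprod r s).
Proof.
have [_ _ /(_ 1 h r s)] := pP; rewrite scale1r /dprod /hact => ->.
elim/htens2_ind: (p r s) => [|z z' IHz IHz'|f v].
- by rewrite lact20 kappa20 (bilin0r (twist_bilin2 _ _)).
- by rewrite lact2D !kappa2D (bilinDr (twist_bilin2 _ _)) IHz IHz'.
by rewrite lact2E otimesM mulr1 mul1r kappa2_1 kappa2E.
Qed.

Lemma dprod_bilin : bilin dprod.
Proof.
have [pl pr _] := pP; split=> [s c r r'|r c s s'].
  rewrite {1}/dprod pl kappa2D; congr (_ + _); rewrite -/(dprod _ _) krestr_scaleE.
  rewrite dprod_hactl; elim/tensk_ind: (dprod r s) => [|z z' IHz IHz'|f v].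
  - by rewrite !raddf0.
  - by rewrite !raddfD /= IHz IHz'.
  by rewrite tmapkE /= /lmulk mulr_algl otimesZl.
rewrite {1}/dprod pr kappa2D; congr (_ + _); rewrite -/(dprod _ _) krestr_scaleE.
by rewrite dprod_hactr (bilinZl (twist_bilin2 _ _)) twist1.
Qed.

(** This is the x-product at x = 1, since the antipode preserves the counit. *)
Definition dot (r s : V) : V := contract (@counit k g br) (dprod r s).

Lemma dot_bilin : bilin dot.
Proof. by split=> [s c r r'|r c s s']; rewrite /dot ?dprod_bilin.1 ?dprod_bilin.2 linearP. Qed.

(** The proof argument supplies the bilinearity from which the linear structures of [dotl] and
    [dotr] are built. *)
Definition dotl (_ : pseudoproduct p) (r : V) : V -> V := dot r.
Definition dotr (_ : pseudoproduct p) (s : V) : V -> V := dot^~ s.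
HB.instance Definition _ r :=
  GRing.isLinear.Build k V V *:%R (dotl pP r) (dot_bilin.2 r).
HB.instance Definition _ s :=
  GRing.isLinear.Build k V V *:%R (dotr pP s) (dot_bilin.1 s).

Fact dassocl_bilin c : bilin (fun h u => tmapk (lcoprod h) idfun (dprod u c)).
Proof.
split=> [u d h h'|h d u u']; last by rewrite dprod_bilin.1 linearP.
elim/tensk_ind: (dprod u c) => [|z z' IHz IHz'|f v].
- by rewrite !raddf0 addr0.
- by rewrite !raddfD /= IHz IHz' addrACA.
by rewrite !tmapkE /= lcoprodP otimesDl otimesZl.
Qed.

Fact dassocr_bilin r : bilin (fun f v => tmapk (@otimesl H H f) idfun (dprod r v)).
Proof.
split=> [v d f f'|f d v v']; last by rewrite dprod_bilin.2 linearP.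
elim/tensk_ind: (dprod r v) => [|z z' IHz IHz'|h u].
- by rewrite !raddf0 addr0.
- by rewrite !raddfD /= IHz IHz' addrACA.
by rewrite !tmapkE /= /otimesl otimesDr otimesDl otimesZr otimesZl.
Qed.

Definition hpure3 (w : H3) (r : R) : htens3 R := tpure _ _ w r.

(** The common form of the inner maps of [pprod_l], with [phi] = [coprod_id], and of [pprod_r], with
    [phi] = [id_coprod]; for the latter, compatibility with balancing is coassociativity. *)
Definition tmap3 (phi : H2 -> H3) (w : H3) (z : htens2 R) : htens3 R :=
  tmap (fun t : H2 => w * phi t) (fun r : R => r) z.

Section Map3.
Variable phi : H2 -> H3.
Hypothesis phiD : {morph phi : t u / t + u}.
Hypothesis phiM : {morph phi : t u / t * u}.
Hypothesis phi_coprod : forall h, phi (coprod h) = coprod_id (coprod h).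

Fact tmap3_balanced (w : H3) : balanced (@ract2 k g br) (fun h (r : R) => h *: r)
  (fun t r => hpure3 (w * phi t) r).
Proof.
split=> [r t t'|t r r'|t h r].
- by rewrite phiD mulrDr; apply: tpureDl.
- exact: tpureDr.
by rewrite /ract2 phiM phi_coprod mulrA; apply: tpure_bal.
Qed.

Lemma tmap3E w t r : tmap3 phi w (hpure2 t r) = hpure3 (w * phi t) r.
Proof. exact: (tliftE (tmap3_balanced w)). Qed.

Lemma tmap30 w : tmap3 phi w 0 = 0.
Proof. exact: (tlift0 (tmap3_balanced w)). Qed.

Lemma tmap3D w : {morph tmap3 phi w : z z' / z + z'}.
Proof. exact: (tliftD (tmap3_balanced w)). Qed.

Lemma tmap3Dl w w' z : tmap3 phi (w + w') z = tmap3 phi w z + tmap3 phi w' z.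
Proof.
elim/htens2_ind: z => [|z z' IHz IHz'|f v]; first by rewrite !tmap30 addr0.
  by rewrite !tmap3D IHz IHz' addrACA.
by rewrite !tmap3E mulrDl; apply: tpureDl.
Qed.

Lemma tmap3_lact2 w u z : tmap3 phi w (lact2 u z) = tmap3 phi (w * phi u) z.
Proof.
elim/htens2_ind: z => [|z z' IHz IHz'|f v]; first by rewrite lact20 !tmap30.
  by rewrite lact2D !tmap3D IHz IHz'.
by rewrite lact2E !tmap3E phiM mulrA.
Qed.

End Map3.

Let coprod_idD : {morph (@coprod_id k g br) : t u / t + u}.
Proof. by move=> t u; rewrite !coprod_idE raddfD. Qed.

Let id_coprodD : {morph (@id_coprod k g br) : t u / t + u}.
Proof. by move=> t u; rewrite !id_coprodE raddfD. Qed.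

Let coprod_id_tmap3 := (tmap30 coprod_idD (@coprod_idM k g br) (fun=> erefl),
  tmap3E coprod_idD (@coprod_idM k g br) (fun=> erefl)).
Let coprod_id_tmap3D := tmap3D coprod_idD (@coprod_idM k g br) (fun=> erefl).

Let id_coprod_tmap3 :=
  (tmap30 id_coprodD (@id_coprodM k g br) (fun h => esym (coprod_coassoc h)),
   tmap3E id_coprodD (@id_coprodM k g br) (fun h => esym (coprod_coassoc h))).
Let id_coprod_tmap3D :=
  tmap3D id_coprodD (@id_coprodM k g br) (fun h => esym (coprod_coassoc h)).

Lemma pprod_l_balanced c : balanced (@ract2 k g br) (fun h (r : R) => h *: r)
  (fun u d => tmap3 (@coprod_id k g br) (u ⊗ 1) (p d c)).
Proof.
have [pl _ pH] := pP; split=> [d u u'|u d d'|u h d].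
- by rewrite otimesDl (tmap3Dl coprod_idD (@coprod_idM k g br) (fun=> erefl)).
- by rewrite pl coprod_id_tmap3D.
have := pH h 1 d c; rewrite scale1r => ->.
rewrite (tmap3_lact2 coprod_idD (@coprod_idM k g br) (fun=> erefl)).
by rewrite coprod_idE tmapkE otimesM mulr1.
Qed.

Lemma pprod_r_balanced a : balanced (@ract2 k g br) (fun h (r : R) => h *: r)
  (fun u d => tmap3 (@id_coprod k g br) (one_otimes u) (p a d)).
Proof.
have idC h := esym (@coprod_coassoc k g br h).
have [_ pr pH] := pP; split=> [d u u'|u d d'|u h d].
- by rewrite !one_otimesE raddfD (tmap3Dl id_coprodD (@id_coprodM k g br) idC).
- by rewrite pr id_coprod_tmap3D.
have := pH 1 h a d; rewrite scale1r => ->.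
rewrite (tmap3_lact2 id_coprodD (@id_coprodM k g br) idC).
by rewrite id_coprod_one_otimes -one_otimesM.
Qed.

Lemma pprod_lE z c :
  pprod_l p z c = tlift (fun u d => tmap3 (@coprod_id k g br) (u ⊗ 1) (p d c)) z.
Proof. by []. Qed.

Lemma pprod_rE a z :
  pprod_r p a z = tlift (fun u d => tmap3 (@id_coprod k g br) (one_otimes u) (p a d)) z.
Proof. by []. Qed.

Lemma kappa3_pprod_l z c : kappa3 (pprod_l p z c) = tlin (dassocl_bilin c) (kappa2 z).
Proof.
rewrite pprod_lE; elim/htens2_ind: z => [|z z' IHz IHz'|f u].
- by rewrite (tlift0 (pprod_l_balanced c)) kappa20 raddf0 kappa30.
- by rewrite (tliftD (pprod_l_balanced c)) kappa2D kappa3D raddfD /= IHz IHz'.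
rewrite (tliftE (pprod_l_balanced c)) kappa2_1 tlinE /dprod.
elim/htens2_ind: (p u c) => [|z z' IHz IHz'|h v].
- by rewrite coprod_id_tmap3 kappa20 raddf0 kappa30.
- by rewrite coprod_id_tmap3D kappa2D kappa3D raddfD /= IHz IHz'.
rewrite coprod_id_tmap3 kappa2_1 tmapkE.
by rewrite coprod_idE tmapkE otimesM mulr1 kappa3_1.
Qed.

Lemma kappa3_pprod_r a z : kappa3 (pprod_r p a z) = tlin (dassocr_bilin a) (kappa2 z).
Proof.
rewrite pprod_rE; elim/htens2_ind: z => [|z z' IHz IHz'|f u].
- by rewrite (tlift0 (pprod_r_balanced a)) kappa20 raddf0 kappa30.
- by rewrite (tliftD (pprod_r_balanced a)) kappa2D kappa3D raddfD /= IHz IHz'.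
rewrite (tliftE (pprod_r_balanced a)) kappa2_1 tlinE /dprod.
elim/htens2_ind: (p a u) => [|z z' IHz IHz'|h v].
- by rewrite id_coprod_tmap3 kappa20 raddf0 kappa30.
- by rewrite id_coprod_tmap3D kappa2D kappa3D raddfD /= IHz IHz'.
rewrite id_coprod_tmap3 kappa2_1 tmapkE one_otimes_pure.
rewrite id_coprod_pure coprod1 tlinE.
by rewrite !otimesM mul1r !mulr1 kappa3_1.
Qed.

Hypothesis pA : forall a b c, pprod_l p (p a b) c = pprod_r p a (p b c).

(* Associativity in untwisted form: with dprod r s = sum h_i (x) u_i,
   dprod u_i c = sum h_ij (x) u_ij, dprod s c = sum f_i (x) v_i and
   dprod r v_i = sum f_ij (x) v_ij, it says that
   sum (h_i (x) 1) Delta(h_ij) (x) u_ij = sum (f_ij (x) f_i) (x) v_ij. *)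
Lemma dprodA r s c :
  tlin (dassocl_bilin c) (dprod r s) = tlin (dassocr_bilin r) (dprod s c).
Proof. by rewrite /dprod -kappa3_pprod_l pA kappa3_pprod_r. Qed.

Lemma contract_counit_mull h (t : H2) :
  contract (@counit k g br) ((h ⊗ 1) * t) = counit h *: contract (@counit k g br) t.
Proof.
elim/tensk_ind: t => [|t t' IHt IHt'|a b]; first by rewrite mulr0 !raddf0.
  by rewrite mulrDr !raddfD /= IHt IHt'.
by rewrite otimesM !contractE /= counitM mul1r scalerA.
Qed.

Lemma contractr_counit_mull h (t : H2) :
  contract (@counit k g br) (tswap ((h ⊗ 1) * t)) =
  h * contract (@counit k g br) (tswap t).
Proof.
elim/tensk_ind: t => [|t t' IHt IHt'|a b]; first by rewrite mulr0 !raddf0 mulr0.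
  by rewrite mulrDr !raddfD /= IHt IHt' mulrDr.
by rewrite otimesM !tswapE !contractE /= mul1r -scalerAr.
Qed.

(** The counit is applied to the first factor of H in [dprodA]: on the left (h (x) 1) Delta(f)
    becomes counit(h) f, on the right the counit falls on the inner product of [r]. *)
Lemma dprod_dotl r s c : dprod (dot r s) c = tmapk idfun (dotl pP r) (dprod s c).
Proof.
have := congr1 (tmapk (contract (@counit k g br)) idfun) (dprodA r s c).
rewrite {1}/dot; set z := dprod r s; set y := dprod s c => E; apply: etrans (etrans E _) => {E}.
  elim/tensk_ind: z => [|z z' IHz IHz'|h u].
  - by rewrite !raddf0 (bilin0l dprod_bilin).
  - by rewrite !raddfD /= (bilinDl dprod_bilin) IHz IHz'.
  rewrite contractE (bilinZl dprod_bilin) tlinE.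
  elim/tensk_ind: (dprod u c) => [|z z' IHz IHz'|f v].
  - by rewrite !raddf0.
  - by rewrite !raddfD /= IHz IHz'.
  rewrite !tmapkE /lcoprod /= /lmulk contract_counit_mull counit_coprodl.
  by rewrite otimesZl.
elim/tensk_ind: y => [|t t' IHz IHz'|f v].
- by rewrite !raddf0.
- by rewrite !raddfD /= IHz IHz'.
rewrite !tmapkE tlinE /= /dotl /dot.
elim/tensk_ind: (dprod r v) => [|t t' IHz IHz'|h u].
- by rewrite !raddf0 (bilin0r (@otimes_bilin _ _ _)).
- by rewrite !raddfD /= IHz IHz' otimesDr.
by rewrite !tmapkE /= /otimesl !contractE otimesZl otimesZr.
Qed.

(** The counit is applied to the second factor of H in [dprodA]: on the left (h (x) 1) Delta(f)
    becomes h f, on the right the counit falls on the product of [s] and [c]. *)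
Lemma dprod_dotr r s c :
  dprod (tlin (@hact_bilin _ _ _ R) (dprod r s)) c = dprod r (dot s c).
Proof.
have := congr1 (tmapk (contract (@counit k g br) \o @tswap _ _ _) idfun) (dprodA r s c).
rewrite /dot; set z := dprod r s; set y := dprod s c => E; apply: etrans (etrans E _) => {E}.
  elim/tensk_ind: z => [|z z' IHz IHz'|h u].
  - by rewrite !raddf0 (bilin0l dprod_bilin).
  - by rewrite !raddfD /= (bilinDl dprod_bilin) IHz IHz'.
  rewrite !tlinE dprod_hactl.
  elim/tensk_ind: (dprod u c) => [|z z' IHz IHz'|f v].
  - by rewrite !raddf0.
  - by rewrite !raddfD /= IHz IHz'.
  rewrite !tmapkE /lcoprod /= /lmulk contractr_counit_mull coprod_swap.
  by rewrite counit_coprodl.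
elim/tensk_ind: y => [|t t' IHz IHz'|f v].
- by rewrite !raddf0 (bilin0r dprod_bilin).
- by rewrite !raddfD /= (bilinDr dprod_bilin) IHz IHz'.
rewrite contractE (bilinZr dprod_bilin) tlinE.
elim/tensk_ind: (dprod r v) => [|t t' IHz IHz'|h u].
- by rewrite !raddf0.
- by rewrite !raddfD /= IHz IHz'.
by rewrite !tmapkE /= /otimesl tswapE contractE otimesZl.
Qed.

Lemma mul_antipode_mull h (t : H2) :
  tlin (mul_antipode_bilin br) ((h ⊗ 1) * t) = h * tlin (mul_antipode_bilin br) t.
Proof.
elim/tensk_ind: t => [|t t' IHt IHt'|a b]; first by rewrite mulr0 !raddf0 mulr0.
  by rewrite mulrDr !raddfD /= IHt IHt' mulrDr.
by rewrite otimesM !tlinE mul1r mulrA.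
Qed.

(** The map a (x) b |-> a S(b) is applied to the two factors of H in [dprodA]: the left side
    collapses by h f_1 S(f_2) = counit(f) h, and the right side only contains tensors h (x) 1. *)
Lemma dprod_dotr_id r b c b' :
  dprod b c = 1 ⊗ b' -> tmapk idfun (dotr pP c) (dprod r b) = dprod r b'.
Proof.
have := congr1 (tmapk (tlin (mul_antipode_bilin br)) idfun) (dprodA r b c).
move=> + bc; rewrite bc tlinE; set z := dprod r b => E; apply: etrans (etrans E _) => {E}.
  elim/tensk_ind: z => [|z z' IHz IHz'|h u].
  - by rewrite !raddf0.
  - by rewrite !raddfD /= IHz IHz'.
  rewrite tmapkE tlinE /= /dotr /dot.
  elim/tensk_ind: (dprod u c) => [|z z' IHz IHz'|f v].
  - by rewrite !raddf0 (bilin0r (@otimes_bilin _ _ _)).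
  - by rewrite !raddfD /= -IHz -IHz' otimesDr.
  rewrite !tmapkE /lcoprod /= /lmulk contractE mul_antipode_mull.
  by rewrite mul_antipode_coprod -scalerAr mulr1 otimesZl otimesZr.
elim/tensk_ind: (dprod r b') => [|t t' IHz IHz'|h u].
- by rewrite !raddf0.
- by rewrite !raddfD /= IHz IHz'.
by rewrite !tmapkE /= /otimesl tlinE antipode1 mulr1.
Qed.

Lemma dotA r s c : dot (dot r s) c = dot r (dot s c).
Proof.
rewrite {1}/dot dprod_dotl {2}/dot.
elim/tensk_ind: (dprod s c) => [|z z' IHz IHz'|h u].
- by rewrite !raddf0 (bilin0r dot_bilin).
- by rewrite !raddfD /= IHz IHz' (bilinDr dot_bilin).
by rewrite tmapkE !contractE (bilinZr dot_bilin).
Qed.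

End Pseudoproducts.

(** * The fixed points of a linear map, and the projection onto them when it is idempotent *)

Section FixedPoints.
Variables (k : fieldType) (V : lmodType k) (t : {linear V -> V}).

Definition fixpred : {pred V} := fun v => t v == v.

Fact fixpred_closed : subsemimod_closed fixpred.
Proof.
split; [split|] => [|u v|c v]; rewrite !unfold_in /=.
- by rewrite raddf0.
- by move=> /eqP tu /eqP tv; rewrite raddfD /= tu tv.
- by move=> /eqP tv; rewrite linearZ /= tv.
Qed.

HB.instance Definition _ := GRing.isSubSemiModClosed.Build k V fixpred fixpred_closed.

Record fixpts : Type := FixPt { fixval : V; fixvalP : fixval \in fixpred }.

HB.instance Definition _ := [isSub for fixval].
HB.instance Definition _ := [Choice of fixpts by <:].
HB.instance Definition _ := [SubChoice_isSubLmodule of fixpts by <:].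

Lemma fixvalE (a : fixpts) : t (fixval a) = fixval a.
Proof. by apply/eqP; case: a. Qed.

Lemma fixval_linear : linear fixval.
Proof. exact: (linearP (val : fixpts -> V)). Qed.
HB.instance Definition _ := GRing.isLinear.Build k fixpts V *:%R fixval fixval_linear.

Hypothesis tK : forall v, t (t v) = t v.

Fact fixproj_subproof v : t v \in fixpred.
Proof. by rewrite unfold_in tK. Qed.

Definition fixproj (v : V) : fixpts := FixPt (fixproj_subproof v).

Lemma val_fixproj v : fixval (fixproj v) = t v.
Proof. by []. Qed.

Lemma fixval_inj : injective fixval.
Proof. exact: val_inj. Qed.

Lemma fixvalK : cancel fixval fixproj.
Proof. by move=> a; apply: fixval_inj; rewrite val_fixproj fixvalE. Qed.

Fact fixproj_linear : linear fixproj.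
Proof. by move=> c u v; apply: fixval_inj; rewrite linearP !val_fixproj linearP. Qed.
HB.instance Definition _ := GRing.isLinear.Build k V fixpts *:%R fixproj fixproj_linear.

End FixedPoints.

Lemma mem_map_iota (T : eqType) (u : nat -> T) n b :
  b \in [seq u i | i <- iota 0 n] -> exists2 i, (i < n)%N & b = u i.
Proof. by case/mapP=> i; rewrite mem_iota => ni ->; exists i. Qed.

(** * The unit, the coaction and the action of X *)

Section UnitalPseudoalgebra.
Variables (k : fieldType) (g : lmodType k) (br : g -> g -> g).

Local Notation H := (uenv br).
Local Notation H2 := (tensk H H).
Local Notation X := (dual H).

Lemma counit_antipode (h : H) : counit (antipode h) = counit h.
Proof.
elim/uenv_lin_ind: h => [|x|c u IH|u v IHu IHv|u v IHu IHv].
- by rewrite antipode1.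
- by rewrite antipode_ugen linearN /= counit_gen oppr0.
- by rewrite !linearZ /= IH.
- by rewrite !raddfD /= IHu IHv.
by rewrite antipodeM !counitM IHu IHv mulrC.
Qed.

Lemma antipodalE (x : X) (h : H) : antipodal x h = pairing x (antipode h).
Proof. by []. Qed.

Lemma eq_contract (A B : lmodType k) (x y : {scalar A}) :
  x =1 y -> contract x =1 contract (B := B) y.
Proof.
move=> xy; elim/tensk_ind => [|t t' IHt IHt'|a b]; first by rewrite !raddf0.
  by rewrite !raddfD /= IHt IHt'.
by rewrite !contractE xy.
Qed.

Lemma contract_tmapk (A A' B B' : lmodType k) (x : {scalar A'}) (f : {linear A -> A'})
    (l : {linear B -> B'}) t :
  contract x (tmapk f l t) = l (contract (x \o f) t).
Proof.
elim/tensk_ind: t => [|t t' IHt IHt'|a b]; first by rewrite !raddf0.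
  by rewrite !raddfD /= IHt IHt'.
by rewrite tmapkE !contractE linearZ.
Qed.

Fact pair_bilin (x y : {scalar H}) : bilin (fun u v : H => x u * y v : k^o).
Proof.
split=> [v c u u'|u c v v'] /=; rewrite linearP.
  by rewrite mulrDl -mulrA.
by rewrite mulrDr mulrCA.
Qed.

Definition pairt (x y : {scalar H}) : H2 -> k := tlin (pair_bilin x y).

Fact pairt_linear x y : scalar (pairt x y).
Proof. exact: (linearP (tlin (pair_bilin x y))). Qed.
HB.instance Definition _ x y :=
  GRing.isLinear.Build k H2 k *%R (pairt x y) (pairt_linear x y).

Lemma pairtE x y u v : pairt x y (u ⊗ v) = x u * y v.
Proof. by rewrite /pairt tlinE. Qed.

(** This is S(x y) = S(x) S(y) in X, dual to [coprod_antipode]. *)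
Lemma pairing_xmul_antipode (x y : X) (h : H) :
  pairing (xmul x y) (antipode h) =
  pairt (antipodal x) (antipodal y) (coprod h).
Proof.
rewrite -[LHS]/(xmul_fun x y (antipode h)) /xmul_fun coprod_antipode.
elim/tensk_ind: (coprod h) => [|t t' IHt IHt'|a b].
- by rewrite !raddf0 (tlift0 (bilin_balanced (xmul_bilin _ _))).
- by rewrite !raddfD /= -IHt -IHt' (tliftD (bilin_balanced (xmul_bilin _ _))).
by rewrite tmapkE (tliftkE (xmul_bilin _ _)) pairtE.
Qed.

Variables (R : lmodType H) (p : pprod R).
Local Notation V := (krestr R).
Hypothesis pP : pseudoproduct p.
Hypothesis pA : forall a b c, pprod_l p (p a b) c = pprod_r p a (p b c).
Hypothesis p_ann : forall a, (forall b, p a b = 0) -> a = 0.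
Variable e : V.
Hypothesis pee : p e e = hpure2 (1 ⊗ 1) (e : R).
Hypothesis e1 : forall r : R, xprod p (xone br) e r = r.

Local Notation mu := (tlin (@hact_bilin _ _ _ R)).
Local Notation "a · b" := (dot p a b) (at level 40, left associativity).

Lemma dot_unitl (r : V) : e · r = r.
Proof.
rewrite -[RHS]e1 xprodE; apply: eq_contract => h.
exact: (esym (counit_antipode h)).
Qed.

Lemma dprod_unit : dprod p e e = 1 ⊗ e.
Proof. by rewrite /dprod pee kappa2_1. Qed.

Lemma mu_dprod_unit (r : V) : mu (dprod p r e) = r.
Proof.
apply/eqP; rewrite -subr_eq0; apply/eqP/p_ann => s.
apply: kappa2_inj; rewrite -/(dprod p _ s) kappa20.
have dB := dprod_bilin pP.
rewrite (bilinDl dB) -scaleN1r (bilinZl dB) scaleN1r.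
by rewrite dprod_dotr // dot_unitl subrr.
Qed.

Lemma dot_unitK (r : V) : r · e · e = r · e.
Proof. by rewrite dotA // dot_unitl. Qed.

Lemma dprod_unitr (a : V) : a · e = a -> dprod p a e = 1 ⊗ a.
Proof. by move=> <-; rewrite dprod_dotl // dprod_unit tmapkE. Qed.

(** For a left factor in A the whole product is determined by the coaction of the right factor, as
    in Diff A. *)
Lemma dprod_fixl (a c : V) : a · e = a ->
  dprod p a c = tmapk idfun (dotl pP a) (dprod p e c).
Proof. by move=> {1}<-; rewrite dprod_dotl. Qed.

(** Every product with a right factor in A lies in H (x) A: [dprod_dotr_id] applies because D(b,e) =
    1 (x) b. *)
Lemma dprod_fixr (r b : V) : b · e = b ->
  tmapk idfun (dotr pP e) (dprod p r b) = dprod p r b.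
Proof. by move=> be; rewrite (dprod_dotr_id pP pA r (dprod_unitr be)). Qed.

Definition coact (c : V) : tensk H V := dprod p e c.

Fact coact_linear : linear coact.
Proof. exact: (dprod_bilin pP).2. Qed.
HB.instance Definition _ := GRing.isLinear.Build k V (tensk H V) *:%R coact coact_linear.

Fact mul_bilin : bilin (fun u v : H => u * v).
Proof.
split=> [v c u u'|u c v v']; first by rewrite mulrDl -scalerAl.
by rewrite mulrDr -scalerAr.
Qed.

(** By [dprod_dotr] the left side is D(mu D(e,a), b). As [a] is in A, the right factors of D(e,a)
    may be taken of the form u . e, and [dprod_fixl] computes their products with [b]. *)
Lemma coact_dot (a b : V) : a · e = a ->
  coact (a · b) = tmul2 mul_bilin (dot_bilin pP) (coact a) (coact b).
Proof.
move=> ae; rewrite /coact -dprod_dotr // -(dprod_fixr e ae).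
have dB := dprod_bilin pP; have mB := tmul2_bilin mul_bilin (dot_bilin pP).
elim/tensk_ind: (dprod p e a) => [|t t' IHt IHt'|h u].
- by rewrite !raddf0 (bilin0l dB) (bilin0l mB).
- by rewrite !raddfD /= (bilinDl dB) (bilinDl mB) IHt IHt'.
rewrite tmapkE tlinE /= dprod_hactl // /dotr (dprod_fixl _ (dot_unitK u)).
elim/tensk_ind: (dprod p e b) => [|t t' IHt IHt'|f v].
- by rewrite !raddf0 (bilin0r mB).
- by rewrite !raddfD /= (bilinDr mB) IHt IHt'.
by rewrite !tmapkE tmul2E.
Qed.

(** Associativity for e, e, c, where D(e,e) = 1 (x) e. In this coassociativity law the second
    application of the coaction supplies the first factor of H, which is the order that [xactM]
    requires. *)
Lemma coactA c :
  tmapk (@coprod k g br) idfun (coact c) = tlin (dassocr_bilin pP e) (coact c).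
Proof.
rewrite -dprodA // dprod_unit tlinE; apply: eq_tmapk => // h.
exact: (esym (mul1r _)).
Qed.

Definition xact (x : X) (c : V) : V := contract (antipodal x) (coact c).

Lemma xact_bilin : bilin xact.
Proof.
split=> [c d x y|x d c c']; rewrite /xact; last by rewrite !linearP.
elim/tensk_ind: (coact c) => [|t t' IHt IHt'|h u].
- by rewrite !raddf0 addr0.
- by rewrite !raddfD /= IHt IHt' addrACA.
by rewrite !contractE scalerA -scalerDl.
Qed.

Lemma xactM x y c : xact (xmul x y) c = xact x (xact y c).
Proof.
pose m := pairt (antipodal x) (antipodal y).
have := congr1 (contract m) (coactA c).
rewrite contract_tmapk /= (eq_contract (y := antipodal (xmul x y))) => [E|h]; last first.
  by rewrite /= /m -pairing_xmul_antipode.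
rewrite /xact {}E; elim/tensk_ind: (coact c) => [|t t' IHt IHt'|f v].
- by rewrite !raddf0.
- by rewrite !raddfD /= IHt IHt'.
rewrite tlinE contractE contract_tmapk !linearZ /=.
rewrite -/(coact v); elim/tensk_ind: (coact v) => [|t t' IHt IHt'|h u].
- by rewrite !raddf0.
- by rewrite !raddfD /= IHt IHt'.
by rewrite !contractE /= /otimesl /m pairtE scalerA mulrC.
Qed.

Lemma xact1 c : xact (xone br) c = c.
Proof. by have := e1 c; rewrite xprodE. Qed.

(** * The algebra A of fixed points and its structure of X^cop-algebra *)

Local Notation A := (fixpts (dotr pP e)).
Local Notation prA := (@fixproj _ _ (dotr pP e) dot_unitK).

Lemma fixval_dot (a : A) : fixval a · e = fixval a.
Proof. exact: (fixvalE a). Qed.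

(** The projection [prA] only serves to land in the type of fixed points: by [val_mulA], [val_actA]
    and [val_acoact], it does not change the values here and in the next two definitions. *)
Definition mulA_ (a b : A) : A := prA (fixval a · fixval b).
Definition actA_ (x : X) (a : A) : A := prA (xact x (fixval a)).
Definition acoact (a : A) : tensk H A := tmapk idfun prA (coact (fixval a)).
Fact acoact_linear : linear acoact.
Proof. by move=> c a b; rewrite /acoact !linearP. Qed.
HB.instance Definition _ := GRing.isLinear.Build k A (tensk H A) *:%R acoact acoact_linear.

Lemma val_mulA a b : fixval (mulA_ a b) = fixval a · fixval b.
Proof. by rewrite val_fixproj /= /dotr dotA // fixval_dot. Qed.

(** The coaction of a fixed point already lies in H (x) A, by [dprod_fixr]. *)
Lemma val_acoact a : tmapk idfun (@fixval _ _ _) (acoact a) = coact (fixval a).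
Proof.
by rewrite tmapk_comp -[RHS]dprod_fixr ?fixval_dot.
Qed.

Lemma actAE x a : actA_ x a = contract (antipodal x) (acoact a).
Proof. by rewrite contract_tmapk. Qed.

Lemma val_actA x a : fixval (actA_ x a) = xact x (fixval a).
Proof. by rewrite actAE /xact -val_acoact [RHS]contract_tmapk; congr (fixval _); apply: eq_contract. Qed.

Lemma mulA_bilin : bilin mulA_.
Proof.
by split=> [b c a a'|a c b b']; rewrite /mulA_ linearP ?(dot_bilin pP).1 ?(dot_bilin pP).2 linearP.
Qed.

Lemma mulA_assoc : associative mulA_.
Proof. by move=> a b c; apply: fixval_inj; rewrite !val_mulA dotA. Qed.

Lemma actA_bilin : bilin actA_.
Proof.
split=> [a c x y|x c a b]; rewrite /actA_; first by rewrite xact_bilin.1 linearP.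
by rewrite linearP xact_bilin.2 linearP.
Qed.

Lemma actA1 a : actA_ (xone br) a = a.
Proof. by apply: fixval_inj; rewrite val_actA xact1. Qed.

Lemma actAM x y a : actA_ (xmul x y) a = actA_ x (actA_ y a).
Proof. by apply: fixval_inj; rewrite !val_actA xactM. Qed.

Lemma acoact_mul a b :
  acoact (mulA_ a b) = tmul2 mul_bilin mulA_bilin (acoact a) (acoact b).
Proof.
rewrite {1}/acoact val_mulA coact_dot ?fixval_dot // -!val_acoact.
have mB := tmul2_bilin mul_bilin (dot_bilin pP).
have mA := tmul2_bilin mul_bilin mulA_bilin.
elim/tensk_ind: (acoact a) => [|t t' IHt IHt'|h u].
- by rewrite (bilin0l mA) !raddf0 (bilin0l mB) raddf0.
- by rewrite (bilinDl mA) !raddfD /= (bilinDl mB) raddfD /= IHt IHt'.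
elim/tensk_ind: (acoact b) => [|t t' IHt IHt'|f v].
- by rewrite (bilin0r mA) !raddf0 (bilin0r mB) raddf0.
- by rewrite (bilinDr mA) !raddfD /= (bilinDr mB) raddfD /= IHt IHt'.
by rewrite !tmapkE !tmul2E tmapkE.
Qed.

Lemma actA_sum x a n (f : nat -> H) (u : nat -> A) :
  acoact a = \sum_(i < n) f i ⊗ u i ->
  actA_ x a = \sum_(i < n) pairing x (antipode (f i)) *: u i.
Proof.
move=> aE; rewrite actAE aE raddf_sum /=; apply: eq_bigr => i _.
by rewrite contractE.
Qed.

(* The right factors are chosen independent, so that x kills a only if it kills
   every left factor. *)
Lemma acoact_rep a : exists n (f : nat -> H) (u : nat -> A),
  acoact a = \sum_(i < n) f i ⊗ u i /\
  forall i, (i < n)%N -> perp (annih actA_ a) (antipode (f i)).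
Proof.
have [n [u [f [y [aE yu]]]]] := tensk_dual_rep (tswap (acoact a)).
have {}aE : acoact a = \sum_(i < n) f i ⊗ u i.
  have sK t : tswap (tswap t) = t :> tensk H A.
    elim/tensk_ind: t => [|t t' IHt IHt'|h v]; first by rewrite !raddf0.
      by rewrite !raddfD /= IHt IHt'.
    by rewrite !tswapE.
  by rewrite -[LHS]sK aE raddf_sum /=; apply: eq_bigr => i _; rewrite tswapE.
exists n, f, u; split=> // i ni x; rewrite /annih /= (actA_sum _ aE) => x0.
have := congr1 (pairing (y i)) x0.
rewrite (pairing_sumr _ _ (fun j => pairing x (antipode (f j)) *: u j)).
rewrite (bigD1 (Ordinal ni)) //= big1 => [|j /negPf]; rewrite pairing_scaler.
  by rewrite yu // eqxx mulr1 addr0 [pairing _ 0]raddf0.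
by rewrite -val_eqE /= eq_sym yu // => ->; rewrite mulr0.
Qed.

Lemma actA_fin a : finite_codim (annih actA_ a).
Proof.
have [n [f [u [aE _]]]] := acoact_rep a.
apply: (@finite_codim_ker _ _ n (fun i x => pairing x (antipode (f i)))).
  by move=> i c x y.
by move=> x x0; rewrite /annih /= (actA_sum _ aE) big1 // => i _; rewrite x0 ?scale0r.
Qed.

(** The coaction is multiplicative, and the antipode reverses the two factors of H, so the factor
    belonging to [b] comes first: this is the opposite coproduct. The hypothesis on [s] applies
    because [acoact_rep] places the factors in the two orthogonals. *)
Lemma actA_mul (x : X) a b (s : seq (X * X)) :
  (forall f h, perp (annih actA_ b) f -> perp (annih actA_ a) h ->
     pairing x (f * h) = \sum_(q <- s) pairing q.1 f * pairing q.2 h) ->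
  actA_ x (mulA_ a b) = \sum_(q <- s) mulA_ (actA_ q.2 a) (actA_ q.1 b).
Proof.
have [n [f [u [aE fP]]]] := acoact_rep a.
have [m [h [w [bE hP]]]] := acoact_rep b.
move=> xs; have mA := tmul2_bilin mul_bilin mulA_bilin.
rewrite actAE acoact_mul aE bE (bilin_suml mA) raddf_sum /=.
under [RHS]eq_bigr => q _.
  rewrite (actA_sum _ aE) (actA_sum _ bE) (bilin_suml mulA_bilin).
  over.
rewrite exchange_big /=; apply: eq_bigr => i _.
rewrite (bilin_sumr mA) raddf_sum /=.
under [RHS]eq_bigr => q _ do rewrite (bilin_sumr mulA_bilin).
rewrite exchange_big /=; apply: eq_bigr => j _.
rewrite tmul2E contractE /= antipodalE antipodeM xs; [|exact: hP|exact: fP].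
rewrite scaler_suml; apply: eq_bigr => q _.
by rewrite (bilinZl mulA_bilin) (bilinZr mulA_bilin) scalerA mulrC.
Qed.

Definition diff_algebra : xcop_algebra br :=
  XcopAlgebra mulA_bilin mulA_assoc actA_bilin actA1 actAM actA_fin actA_mul.

(** * The isomorphism with Diff A *)

Local Notation D := (diffmod br diff_algebra).

Lemma diffmod_scaleE (h : H) (t : D) : h *: t = tmapk (lmulk h) idfun t.
Proof. by []. Qed.

Definition to_diff (r : R) : D := tmapk idfun prA (dprod p r e).

Definition of_diff (t : D) : R := mu (tmapk idfun (@fixval _ _ (dotr pP e)) t).

Fact to_diff_linear : linear to_diff.
Proof.
move=> h r s; rewrite diffmod_scaleE /to_diff (bilinDl (dprod_bilin pP) (hact h r)) raddfD /=.
congr (_ + _); rewrite dprod_hactl //.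
elim/tensk_ind: (dprod p r e) => [|t t' IHt IHt'|f v]; first by rewrite !raddf0.
  by rewrite !raddfD /= IHt IHt'.
by rewrite !tmapkE.
Qed.
HB.instance Definition _ := GRing.isLinear.Build H R D *:%R to_diff to_diff_linear.

Lemma of_diffE (h : H) (a : A) : of_diff (h ⊗ a) = hact h (fixval a).
Proof. by rewrite /of_diff tmapkE tlinE. Qed.

Lemma of_diff0 : of_diff 0 = 0.
Proof. by rewrite /of_diff !raddf0. Qed.

Lemma of_diffD t t' : of_diff (t + t') = of_diff t + of_diff t'.
Proof. by rewrite /of_diff !raddfD. Qed.

(** Projecting the right factors of D(r,e) changes nothing, since e . e = e, and [mu_dprod_unit]
    then gives back [r]. *)
Lemma to_diffK : cancel to_diff of_diff.
Proof.
move=> r; rewrite /of_diff /to_diff tmapk_comp -[RHS]mu_dprod_unit.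
by congr (mu _); rewrite -[RHS](dprod_fixr _ (dot_unitl e)).
Qed.

Lemma to_diff_fixval (a : A) : to_diff (fixval a) = 1 ⊗ a.
Proof. by rewrite /to_diff (dprod_unitr (fixval_dot a)) tmapkE /= fixvalK. Qed.

Lemma of_diffK : cancel of_diff to_diff.
Proof.
elim/tensk_ind => [|t t' IHt IHt'|h a].
- by rewrite of_diff0 raddf0.
- by rewrite of_diffD raddfD /= IHt IHt'.
rewrite of_diffE -[hact h _]/(h *: (fixval a : R)) linearZ /= to_diff_fixval.
by rewrite diffmod_scaleE tmapkE /= /lmulk mulr1.
Qed.

(** The product of [R] transported along the bijection: the isomorphism is then immediate, and the
    content lies in checking the formula of Diff A. *)
Definition diff_prod : pprod D := fun t u =>
  tmap (fun w : H2 => w) to_diff (p (of_diff t) (of_diff u)).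

Lemma diff_prod_pseudo : pseudoproduct diff_prod.
Proof.
have ofZ h t : of_diff (h *: t) = h *: of_diff t.
  by apply: (can_inj to_diffK); rewrite linearZ /= !of_diffK.
have [pl pr pH] := pP; split=> [u t t'|t u u'|f h t u].
- by rewrite /diff_prod of_diffD pl htmapD.
- by rewrite /diff_prod of_diffD pr htmapD.
by rewrite /diff_prod !ofZ pH htmap_lact2.
Qed.

Lemma xprod_fixl x (a : A) (c : V) :
  xprod p x (fixval a) c = fixval a · xact x c.
Proof.
rewrite xprodE -/(dprod p _ _) (dprod_fixl _ (fixval_dot a)) contract_tmapk /=.
by congr (_ · _); apply: eq_contract.
Qed.

Lemma diff_prodP : diff_pprod diff_prod.
Proof.
split=> [|x a b]; first exact: diff_prod_pseudo.
rewrite xprodE contract_htmap -xprodE !of_diffE !hact1 xprod_fixl.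
by rewrite -val_actA -val_mulA; apply: to_diff_fixval.
Qed.

Lemma diff_iso : pseudo_iso p diff_prod.
Proof.
exists to_diff; first by exists of_diff; [apply: to_diffK|apply: of_diffK].
by move=> a b; rewrite /diff_prod !to_diffK.
Qed.

(** * Finite generation *)

Section Spans.

(* The subspace H (x) <B> of H (x) A. *)
Definition hspan (B : set A) (t : tensk H A) : Prop :=
  forall Q : tensk H A -> Prop, Q 0 -> (forall u v, Q u -> Q v -> Q (u + v)) ->
    (forall h a, B a -> Q (h ⊗ a)) -> Q t.

Variable B : set A.

Lemma hspan0 : hspan B 0.
Proof. by []. Qed.

Lemma hspanD u v : hspan B u -> hspan B v -> hspan B (u + v).
Proof. by move=> Bu Bv Q Q0 QD QB; apply: (QD); [apply: Bu|apply: Bv]. Qed.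

Lemma hspan_pure h a : B a -> hspan B (h ⊗ a).
Proof. by move=> Ba Q _ _; apply. Qed.

Lemma hspan_sum n (F : 'I_n -> tensk H A) :
  (forall i, hspan B (F i)) -> hspan B (\sum_(i < n) F i).
Proof. by move=> BF; apply: (big_ind (hspan B)) => //; apply: hspanD. Qed.

Lemma hspan_sub (B' : set A) u : B `<=` B' -> hspan B u -> hspan B' u.
Proof. by move=> BB' Bu Q Q0 QD QB; apply: Bu => // h a /BB'; apply: QB. Qed.

End Spans.

(* Local finiteness of the coaction: T collects the right factors of coact a for
   an expression with independent left factors. *)
Lemma acoact_finite a : exists T : seq A,
  (forall b, b \in T -> hspan [set` T] (acoact b)) /\ forall h, hspan [set` T] (h ⊗ a).
Proof.
have [n [f [u [x [aE xf]]]]] := tensk_dual_rep (acoact a).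
pose T := [seq u i | i <- iota 0 n]; exists T.
have uT i : (i < n)%N -> [set` T] (u i).
  by move=> ni; rewrite /= map_f // mem_iota.
have TP b : b \in T -> exists2 i, (i < n)%N & b = u i by exact: mem_map_iota.
split=> [b /TP[i ni ->]|h]; last first.
  (* The unit of X acts as the identity, so the counit recovers [a] from its coaction. *)
  have -> : a = \sum_(i < n) counit (f i) *: u i.
    rewrite -[LHS]actA1 actAE aE raddf_sum /=; apply: eq_bigr => i _.
    by rewrite contractE -[counit _]counit_antipode.
  rewrite (bilin_sumr (@otimes_bilin _ _ _)); apply: hspan_sum => i.
  by rewrite -otimesZ; apply: hspan_pure; apply: uT; apply: ltn_ord.
(* [C] evaluates [x i] on the second factor of H. Applied to [coactA], it isolates [acoact (u i)] on
   the right side by duality, while the left side keeps right factors [u j] in [T]. *)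
pose C := tmapk (contract (x i) \o @tswap _ H H) (@idfun A).
pose F t := C (tmapk idfun prA (tlin (dassocr_bilin pP e)
  (tmapk idfun (@fixval _ _ (dotr pP e)) t))).
have F0 : F 0 = 0 by rewrite /F /C !raddf0.
have FD : {morph F : t u / t + u} by move=> t t'; rewrite /F /C !raddfD.
have CE j : (j < n)%N -> F (f j ⊗ u j) = (i == j)%:R *: acoact (u j).
  move=> nj; rewrite /F -xf //.
  rewrite tmapkE tlinE /= -/(coact _) /acoact.
  elim/tensk_ind: (coact _) => [|t t' IHt IHt'|h v]; first by rewrite /C !raddf0.
    by rewrite /C !raddfD /= -IHt -IHt'.
  by rewrite /C !tmapkE /= /otimesl tswapE contractE otimesZl.
have := congr1 (fun t => C (tmapk idfun prA t)) (coactA (fixval (a : A))).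
have -> : tmapk idfun prA (tmapk (@coprod k g br) idfun (coact (fixval a))) =
          \sum_(j < n) coprod (f j) ⊗ u j.
  transitivity (tmapk (@coprod k g br) idfun (acoact a)).
    by rewrite /acoact !tmapk_comp; apply: eq_tmapk.
  by rewrite aE raddf_sum /=; apply: eq_bigr => j _; rewrite tmapkE.
rewrite -val_acoact -/(F _) aE (big_morph F FD F0) (eq_bigr _ (fun (j : 'I_n) _ => CE j (ltn_ord j))).
have -> : \sum_(j < n) (i == j)%:R *: acoact (u j) = acoact (u i).
  rewrite (bigD1 (Ordinal ni)) //= eqxx scale1r big1 ?addr0 // => j.
  by rewrite -val_eqE /= eq_sym => /negPf ->; rewrite scale0r.
move=> <-; rewrite /C raddf_sum; apply: hspan_sum => j /=.
by rewrite tmapkE; apply: hspan_pure; apply: uT; apply: ltn_ord.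
Qed.

Lemma hspan_finite (z : tensk H A) : exists T : seq A,
  (forall b, b \in T -> hspan [set` T] (acoact b)) /\ hspan [set` T] z.
Proof.
elim/tensk_ind: z => [|t t' [T [TT Tt]] [T' [TT' Tt']]|h a].
- by exists [::]; split=> [b|]; [rewrite in_nil|apply: hspan0].
- have sT : [set` T] `<=` [set` T ++ T'] by move=> b /= bT; rewrite mem_cat bT.
  have sT' : [set` T'] `<=` [set` T ++ T'] by move=> b /= bT; rewrite mem_cat bT orbT.
  exists (T ++ T'); split; last first.
    by apply: hspanD; [apply: hspan_sub sT _|apply: hspan_sub sT' _].
  move=> b; rewrite mem_cat => /orP[/TT|/TT'].
    exact: hspan_sub.
  exact: hspan_sub.
by have [T [TT Ta]] := acoact_finite a; exists T.
Qed.

Lemma hspan_finite_seq (s : seq R) : exists T : seq A,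
  (forall b, b \in T -> hspan [set` T] (acoact b)) /\
  (forall r, r \in s -> hspan [set` T] (to_diff r)).
Proof.
elim: s => [|r s [T [TT Ts]]]; first by exists [::]; split=> b; rewrite in_nil.
have [T' [TT' Tr]] := hspan_finite (to_diff r).
have sT : [set` T] `<=` [set` T ++ T'] by move=> b /= bT; rewrite mem_cat bT.
have sT' : [set` T'] `<=` [set` T ++ T'] by move=> b /= bT; rewrite mem_cat bT orbT.
exists (T ++ T'); split=> [b|r']; rewrite ?mem_cat ?inE.
  by move=> /orP[/TT|/TT']; apply: hspan_sub.
by move=> /predU1P[->|/Ts]; [apply: hspan_sub sT' _|apply: hspan_sub].
Qed.

Definition subalg (Q : set A) : Prop :=
  [/\ Q 0, forall a b, Q a -> Q b -> Q (a + b),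
      forall (c : k) a, Q a -> Q (c *: a) & forall a b, Q a -> Q b -> Q (mulA_ a b)].

(** Since [acoact] is multiplicative, stability of a generated subalgebra under the coaction need
    only be tested on generators. *)
Lemma hspan_acoact (B : set A) :
  subalg B -> subalg [set a | B a /\ hspan B (acoact a)].
Proof.
move=> [B0 BD BZ BM]; split=> [|a b [Ba Ca] [Bb Cb]|c a [Ba Ca]|a b [Ba Ca] [Bb Cb]].
- by split=> //; rewrite raddf0; apply: hspan0.
- by split; [apply: BD|rewrite raddfD; apply: hspanD].
- split; first exact: BZ.
  rewrite linearZ /=; apply: (Ca (fun t => hspan B (c *: t))).
  + by rewrite scaler0; apply: hspan0.
  + by move=> u v Bu Bv; rewrite scalerDr; apply: hspanD.
  by move=> h b Bb; rewrite -otimesZl; apply: hspan_pure.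
split; first exact: BM.
have mA := tmul2_bilin mul_bilin mulA_bilin.
rewrite acoact_mul; apply: (Ca (fun t => hspan B (tmul2 _ _ t _))).
- by rewrite (bilin0l mA); apply: hspan0.
- by move=> u v Bu Bv; rewrite (bilinDl mA); apply: hspanD.
move=> h u Bu; apply: (Cb (fun t => hspan B (tmul2 _ _ _ t))).
- by rewrite (bilin0r mA); apply: hspan0.
- by move=> v w Bv Bw; rewrite (bilinDr mA); apply: hspanD.
by move=> f v Bv; rewrite tmul2E; apply: hspan_pure; apply: BM.
Qed.

(** By additivity both arguments may be taken of the form h a and f b with a, b in [B]. Their
    product comes from D(a,b), whose right factors are a . c with c from the coaction of b, hence in
    [B]. *)
Lemma hspan_sub_pseudoalgebra (B : set A) :
    subalg B -> (forall a, B a -> hspan B (acoact a)) ->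
  sub_pseudoalgebra p [set r | hspan B (to_diff r)].
Proof.
move=> [B0 BD BZ BM] BC.
have PD (r s : R) : hspan B (to_diff r) -> hspan B (to_diff s) -> hspan B (to_diff (r + s)).
  by rewrite raddfD; apply: hspanD.
have PH h (r : R) : hspan B (to_diff r) -> hspan B (to_diff (h *: r)).
  rewrite linearZ /= => Br; apply: (Br (fun t => hspan B (h *: (t : D)))).
  - by rewrite scaler0; apply: hspan0.
  - by move=> u v Bu Bv; rewrite scalerDr; apply: hspanD.
  by move=> f a Ba; rewrite diffmod_scaleE tmapkE; apply: hspan_pure.
have P0 : hspan B (to_diff 0) by rewrite raddf0; apply: hspan0.
split=> // x r s Br Bs; rewrite /= xprodE -/(dprod p r s).
have dB := dprod_bilin pP.
rewrite -(to_diffK r) -(to_diffK s).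
pose P' t u := hspan B (to_diff (contract (antipodal x) (dprod p (of_diff t) (of_diff u)))).
apply: (Br (P'^~ _)) => [|u v|h a Ba]; rewrite /P'.
- by rewrite of_diff0 (bilin0l dB) raddf0.
- by rewrite of_diffD (bilinDl dB) raddfD; apply: PD.
apply: (Bs (P' _)) => [|u v|f b Bb]; rewrite /P'.
- by rewrite of_diff0 (bilin0r dB) raddf0.
- by rewrite of_diffD (bilinDr dB) raddfD; apply: PD.
rewrite !of_diffE dprod_hactl // dprod_hactr // (dprod_fixl _ (fixval_dot a)).
rewrite -/(coact _) -val_acoact.
have tB := twist_bilin2 idfun R.
pose F t := contract (antipodal x) (tmapk (lmulk h) idfun (twist idfun f
  (tmapk idfun (dotl pP (fixval a)) (tmapk idfun (@fixval _ _ (dotr pP e)) t)))).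
have F0 : F 0 = 0 by rewrite /F !raddf0 (bilin0r tB) !raddf0.
have FD t t' : F (t + t') = F t + F t'.
  by rewrite /F !raddfD /= (bilinDr tB) !raddfD.
apply: (BC b Bb (fun t => hspan B (to_diff (F t)))); first by rewrite F0.
  by move=> u v; rewrite FD; apply: PD.
(* The only product formed in A is that of [a] and [c]; the rest contributes scalars and the action
   of H. *)
move=> h' c Bc; rewrite /F !tmapkE /= /dotl -val_mulA contract_tmapk /twist.
elim/tensk_ind: (coprod f) => [|t t' IHt IHt'|f1 f2].
- by rewrite (bilin0l (twist2_bilin _ _)) raddf0.
- by rewrite (bilinDl (twist2_bilin _ _)) [contract _ _]raddfD; apply: PD.
rewrite /twist2 tmul2E contractE /=.
have PHk c' (r' : V) : hspan B (to_diff r') -> hspan B (to_diff (c' *: r' : V)) by apply: PH.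
apply: PHk; apply: PH.
rewrite -[dotr pP e _]/(fixval (mulA_ a c)) to_diff_fixval.
by apply: hspan_pure; apply: BM.
Qed.

Lemma diff_fg : fg_pseudoalgebra p -> fg_algebra diff_algebra.
Proof.
move=> [s sP]; have [T [TT Ts]] := hspan_finite_seq s.
exists T => Q Qalg TQ a.
(* The subalgebra generated by [T], as an intersection. *)
pose B : set A := fun b => forall Q : set A,
  subalg Q -> (forall a, a \in T -> Q a) -> Q b.
have Balg : subalg B.
  split=> [Q' [] //|u v Bu Bv Q' Q'a Q'T|c u Bu Q' Q'a Q'T|u v Bu Bv Q' Q'a Q'T];
    case: (Q'a) => Q0 QD QZ QM.
  - by apply: QD; [apply: Bu|apply: Bv].
  - by apply: QZ; apply: Bu.
  - by apply: QM; [apply: Bu|apply: Bv].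
have TB : [set` T] `<=` B by move=> b bT Q' _; apply.
have BC b : B b -> hspan B (acoact b).
  move=> Bb; apply: (Bb _ (hspan_acoact Balg) _).2 => c cT.
  by split; [apply: TB|apply: hspan_sub TB (TT _ cT)].
have := sP _ (hspan_sub_pseudoalgebra Balg BC).
move=> /(_ _ (fixval a)) /= => Ba.
have {}Ba : hspan B (1 ⊗ a).
  by rewrite -to_diff_fixval; apply: Ba => r /Ts; apply: hspan_sub.
suff : B a by apply.
have [B0 BD BZ BM] := Balg.
(* [a] is the contraction of 1 (x) a with the counit, and this contraction maps H (x) B into B. *)
rewrite -[a]scale1r -(counit1 br) -(contractE (@counit k g br) 1 a).
apply: (Ba (fun t => B (contract (@counit k g br) t))).
- by rewrite raddf0.
- by move=> u v Bu Bv; rewrite raddfD; apply: BD.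
by move=> h b Bb; rewrite contractE; apply: BZ.
Qed.

End UnitalPseudoalgebra.

Theorem theorem3p9 (R : realType) (g : vectType R[i]) (br : g -> g -> g)
    (g_lie : lie_bracket br)
    (P : lmodType (uenv br)) (p : pprod P)
    (p_assoc : assoc_pseudoalgebra p) (p_unital : unital p)
    (p_ann : left_annihilator p = [set 0]) :
  exists (A : xcop_algebra br) (q : pprod (diffmod br A)),
    [/\ diff_pprod q, pseudo_iso p q & (fg_pseudoalgebra p -> fg_algebra A)].
Proof.
have [pP pA] := p_assoc; have [phi [_ phiM e1]] := p_unital.
have ann a : (forall b, p a b = 0) -> a = 0.
  by move=> a0; have : left_annihilator p a by []; rewrite p_ann.
(* The unit is the image of the generator of Cur C, whose product with itself [phi] preserves. *)
have ee : p (phi 1) (phi 1) = hpure2 (1 ⊗ 1) (phi 1).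
  by rewrite phiM /cur_prod htmapE.
exists (diff_algebra pP pA ee e1), (diff_prod (pP := pP) (pA := pA) (pee := ee) (e1 := e1)).
by split; [apply: diff_prodP|apply: diff_iso|apply: diff_fg].
Qed.
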